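(* Let $(B_1,B_2,\mu_l,\nu_l,\mu_r,\nu_r)$ be a Hopf datum in a (strict) braided monoidal category $\mathcal C$, and equip $B=B_1\otimes B_2$ with the algebra structure $\mathrm m_B=(\mathrm m_1\otimes\mathrm m_2)\circ(\mathrm{id}_1\otimes\phi_{2,1}\otimes\mathrm{id}_2)$, $\eta_B=\eta_1\otimes\eta_2$ and the coalgebra structure $\Delta_B=(\mathrm{id}_1\otimes\phi_{1,2}\otimes\mathrm{id}_2)\circ(\Delta_1\otimes\Delta_2)$, $\varepsilon_B=\varepsilon_1\otimes\varepsilon_2$. (a) One of the (co)actions $\mu_l,\mu_r,\nu_l,\nu_r$ is trivial if and only if one of the morphisms $\eta_1\otimes\mathrm{id}_{B_2}:B_2\to B$, $\mathrm{id}_{B_1}\otimes\eta_2:B_1\to B$, $\varepsilon_1\otimes\mathrm{id}_{B_2}:B\to B_2$, $\mathrm{id}_{B_1}\otimes\varepsilon_2:B\to B_1$ is both an algebra and a coalgebra morphism. (If these equivalent conditions hold, the Hopf datum is called trivalent.) (b) Every trivalent Hopf datum is recursive of order $\le2$. Therefore $B=B_1\otimes B_2$ with multiplication $\mathrm m_B=(\mathrm m_1\otimes\mathrm m_2)\circ(\mathrm{id}_1\otimes\phi_{2,1}\otimes\mathrm{id}_2)$, unit $\eta_B=\eta_1\otimes\eta_2$, comultiplication $\Delta_B=(\mathrm{id}_1\otimes\phi_{1,2}\otimes\mathrm{id}_2)\circ(\Delta_1\otimes\Delta_2)$ and counit $\varepsilon_B=\varepsilon_1\otimes\varepsilon_2$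 is a bialgebra in $\mathcal C$.
   Context: $\mathcal C$ has tensor product $\otimes$, unit object $I$, braiding $\Psi$, and idempotents in $\mathcal C$ split. Algebras are unital associative, coalgebras counital coassociative, bialgebras are in the braided sense: $\Delta\circ\mathrm m=(\mathrm m\otimes\mathrm m)\circ(\mathrm{id}\otimes\Psi\otimes\mathrm{id})\circ(\Delta\otimes\Delta)$, with $\varepsilon$ an algebra morphism and $\eta$ a coalgebra morphism. Write $\mathrm{id}_j=\mathrm{id}_{B_j}$, $\Psi_{i,j}=\Psi_{B_i,B_j}$. Hopf datum. A Hopf datum $(B_1,B_2,\mu_l,\nu_l,\mu_r,\nu_r)$ consists of objects $B_1,B_2$, each an algebra $(\mathrm m_j,\eta_j)$ and a coalgebra $(\Delta_j,\varepsilon_j)$ such that $\varepsilon_j$ is an algebra morphism and $\eta_j$ is a coalgebra morphism; a left $B_2$-module structure $\mu_l:B_2\otimes B_1\to B_1$ and a left $B_2$-comodule structure $\nu_l:B_1\to B_2\otimes B_1$ on $B_1$; a right $B_1$-module structure $\mu_r:B_2\otimes B_1\to B_2$ and a right $B_1$-comodule structure $\nu_r:B_2\to B_2\otimes B_1$ on $B_2$. Put $\phi_{1,2}=(\mathrm m_2\otimes\mathrm m_1)\circ(\mathrm{id}_2\otimes\Psi_{1,2}\otimes\mathrm{id}_1)\circ(\nu_l\otimes\nu_r)$ and $\phi_{2,1}=(\mu_l\otimes\mu_r)\circ(\mathrm{id}_2\otimes\Psi_{2,1}\otimes\mathrm{id}_1)\circ(\Delta_2\otimes\Delta_1)$. Required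 identities: - $\mu_r\circ(\eta_2\otimes\mathrm{id}_1)=\eta_2\circ\varepsilon_1=(\mathrm{id}_2\otimes\varepsilon_1)\circ\nu_l$; $\varepsilon_2\circ\mu_r=\varepsilon_2\otimes\varepsilon_1=\varepsilon_1\circ\mu_l$; $\mu_l\circ(\mathrm{id}_2\otimes\eta_1)=\eta_1\circ\varepsilon_2=(\varepsilon_2\otimes\mathrm{id}_1)\circ\nu_r$; $\nu_r\circ\eta_2=\eta_2\otimes\eta_1=\nu_l\circ\eta_1$. - Algebra-coalgebra: $\Delta_1\mathrm m_1=(\mathrm m_1\otimes\mathrm m_1)\circ(\mathrm{id}_1\otimes\mu_l\otimes\mathrm{id}_1\otimes\mathrm{id}_1)\circ(\mathrm{id}_1\otimes\mathrm{id}_2\otimes\Psi_{1,1}\otimes\mathrm{id}_1)\circ(\mathrm{id}_1\otimes\nu_l\otimes\mathrm{id}_1\otimes\mathrm{id}_1)\circ(\Delta_1\otimes\Delta_1)$ and $\Delta_2\mathrm m_2=(\mathrm m_2\otimes\mathrm m_2)\circ(\mathrm{id}_2\otimes\mathrm{id}_2\otimes\mu_r\otimes\mathrm{id}_2)\circ(\mathrm{id}_2\otimes\Psi_{2,2}\otimes\mathrm{id}_1\otimes\mathrm{id}_2)\circ(\mathrm{id}_2\otimes\mathrm{id}_2\otimes\nu_r\otimes\mathrm{id}_2)\circ(\Delta_2\otimes\Delta_2)$. - Module-comodule: $\phi_{1,2}\circ\phi_{2,1}=(\mathrm m_2\otimes\mathrm m_1)\circ(\mu_r\otimes\Psi_{1,2}\otimes\mu_l)\circ(\mathrm{id}_2\otimes\Psi_{1,1}\otimes\Psi_{2,2}\otimes\mathrm{id}_1)\circ(\nu_r\otimes\Psi_{2,1}\otimes\nu_l)\circ(\Delta_2\otimes\Delta_1)$.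 - Module-algebra: $\mu_r(\mathrm m_2\otimes\mathrm{id}_1)=\mathrm m_2(\mu_r\otimes\mathrm{id}_2)(\mathrm{id}_2\otimes\phi_{2,1})$; $\mu_l(\mathrm{id}_2\otimes\mathrm m_1)=\mathrm m_1(\mathrm{id}_1\otimes\mu_l)(\phi_{2,1}\otimes\mathrm{id}_1)$. - Comodule-coalgebra: $(\Delta_2\otimes\mathrm{id}_1)\nu_r=(\mathrm{id}_2\otimes\phi_{1,2})(\nu_r\otimes\mathrm{id}_2)\Delta_2$; $(\mathrm{id}_2\otimes\Delta_1)\nu_l=(\phi_{1,2}\otimes\mathrm{id}_1)(\mathrm{id}_1\otimes\nu_l)\Delta_1$. - Module-coalgebra: $\Delta_2\mu_r=(\mathrm m_2\otimes\mu_r)(\mu_r\otimes\Psi_{2,2}\otimes\mathrm{id}_1)(\mathrm{id}_2\otimes\Psi_{2,1}\otimes\nu_l)(\Delta_2\otimes\Delta_1)$; $\Delta_1\mu_l=(\mu_l\otimes\mathrm m_1)(\mathrm{id}_2\otimes\Psi_{1,1}\otimes\mu_l)(\nu_r\otimes\Psi_{2,1}\otimes\mathrm{id}_1)(\Delta_2\otimes\Delta_1)$. - Comodule-algebra: $\nu_r\mathrm m_2=(\mathrm m_2\otimes\mathrm m_1)(\mathrm{id}_2\otimes\Psi_{1,2}\otimes\mu_l)(\nu_r\otimes\Psi_{2,2}\otimes\mathrm{id}_1)(\Delta_2\otimes\nu_r)$; $\nu_l\mathrm m_1=(\mathrm m_2\otimes\mathrm m_1)(\mu_r\otimes\Psi_{1,2}\otimes\mathrm{id}_1)(\mathrm{id}_2\otimes\Psi_{1,1}\otimes\nu_l)(\nu_l\otimes\Delta_1)$.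 For every Hopf datum $(B,\mathrm m_B,\eta_B)$ is an algebra and $(B,\Delta_B,\varepsilon_B)$ a coalgebra. Trivial (co)actions: $\mu_l=\varepsilon_2\otimes\mathrm{id}_1$, $\mu_r=\mathrm{id}_2\otimes\varepsilon_1$, $\nu_l=\eta_2\otimes\mathrm{id}_1$, $\nu_r=\mathrm{id}_2\otimes\eta_1$, respectively. The map $\Phi$. For $f\in\mathrm{End}_{\mathcal C}(B_1\otimes B_2\otimes B_1\otimes B_2)$, $\Phi(f)\in\mathrm{End}_{\mathcal C}(B_1\otimes B_2\otimes B_1\otimes B_2)$ is $$\Phi(f)=(L'\otimes Q\otimes R')\circ(\mathrm{id}_1\otimes\mathrm{id}_2\otimes\Psi_{1,1}\otimes f\otimes\Psi_{2,2}\otimes\mathrm{id}_1\otimes\mathrm{id}_2)\circ(L\otimes P\otimes R),$$ where $L=(\mathrm{id}_1\otimes\nu_l)\circ\Delta_1$, $R=(\nu_r\otimes\mathrm{id}_2)\circ\Delta_2$, $L'=\mathrm m_1\circ(\mathrm{id}_1\otimes\mu_l)$, $R'=\mathrm m_2\circ(\mu_r\otimes\mathrm{id}_2)$, $$P=(\mu_l\otimes\mathrm{id}_1\otimes\mathrm{id}_2\otimes\mathrm{id}_1\otimes\mathrm{id}_2\otimes\mu_r)\circ(\mathrm{id}_2\otimes\Psi_{1,1}\otimes\mathrm{id}_2\otimes\mathrm{id}_1\otimes\Psi_{2,2}\otimes\mathrm{id}_1)\circ(\nu_r\otimes\Psi_{2,1}\otimes\Psi_{2,1}\otimes\nu_l)\circ(\Delta_2\otimes\Psi_{2,1}\otimes\Delta_1)\circ(\Delta_2\otimes\Delta_1)$$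 is a morphism $B_2\otimes B_1\to B_1\otimes B_1\otimes B_2\otimes B_1\otimes B_2\otimes B_2$, and $$Q=(\mathrm m_2\otimes\mathrm m_1)\circ(\mathrm m_2\otimes\Psi_{1,2}\otimes\mathrm m_1)\circ(\mu_r\otimes\Psi_{1,2}\otimes\Psi_{1,2}\otimes\mu_l)\circ(\mathrm{id}_2\otimes\Psi_{1,1}\otimes\mathrm{id}_2\otimes\mathrm{id}_1\otimes\Psi_{2,2}\otimes\mathrm{id}_1)\circ(\nu_l\otimes\mathrm{id}_1\otimes\mathrm{id}_2\otimes\mathrm{id}_1\otimes\mathrm{id}_2\otimes\nu_r)$$ is a morphism $B_1\otimes B_1\otimes B_2\otimes B_1\otimes B_2\otimes B_2\to B_2\otimes B_1$. Recursive of order $n_0$. Let $\pi=\eta_1\circ\varepsilon_1\otimes\mathrm{id}_{B_2\otimes B_1}\otimes\eta_2\circ\varepsilon_2$. A Hopf datum is recursive if for every endomorphism $f$ of $B_1\otimes B_2\otimes B_1\otimes B_2$ there is an integer $n\ge0$ with $\Phi^n(f)=\Phi^n(\pi\circ f\circ\pi)$. If the set of integers $n\ge0$ such that $\Phi^n(f)=\Phi^n(\pi\circ f\circ\pi)$ for all such $f$ is non-empty, with minimum $n_0$, the Hopf datum is recursive of order $n_0$. *)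

(* Defs.v *)
From mathcomp Require Import all_boot.

Set Implicit Arguments.
Unset Strict Implicit.
Unset Printing Implicit Defensive.

Declare Scope obj_scope.
Delimit Scope obj_scope with obj.
Declare Scope mor_scope.
Delimit Scope mor_scope with mor.

(* Categories are presented by one collection of morphisms with domain and
   codomain maps.  With this presentation the strict laws of a strict monoidal
   category, such as (f ⊗ g) ⊗ h = f ⊗ (g ⊗ h), are plain equations between
   morphisms, and no transport along (A ⊗ B) ⊗ C = A ⊗ (B ⊗ C) is needed.
   Composition is a total function, but it is constrained only on composable
   pairs: every category gives such a structure by choosing arbitrary values on
   the other pairs. *)
Record category := Category {
  obj : Type;
  mor : Type;
  dom : mor -> obj;
  cod : mor -> obj;
  idm : obj -> mor;
  comp : mor -> mor -> mor;
  dom_idm : forall A, dom (idm A) = A;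
  cod_idm : forall A, cod (idm A) = A;
  dom_comp : forall g f, dom g = cod f -> dom (comp g f) = dom f;
  cod_comp : forall g f, dom g = cod f -> cod (comp g f) = cod g;
  comp_idl : forall f, comp (idm (cod f)) f = f;
  comp_idr : forall f, comp f (idm (dom f)) = f;
  comp_assoc : forall h g f, dom h = cod g -> dom g = cod f ->
    comp h (comp g f) = comp (comp h g) f }.

Arguments idm {c}.
Arguments comp {c}.
Bind Scope obj_scope with obj.
Bind Scope mor_scope with mor.
Notation "g ∘ f" := (comp g%mor f%mor)
  (at level 50, left associativity) : mor_scope.

Definition hom (C : category) (A B : obj C) (f : mor C) : Prop :=
  dom f = A /\ cod f = B.

Definition idempotents_split (C : category) : Prop :=
  forall (A : obj C) (e : mor C), hom A A e -> (e ∘ e)%mor = e ->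
  exists (X : obj C) (i p : mor C),
    [/\ hom X A i, hom A X p, (p ∘ i)%mor = idm X & (i ∘ p)%mor = e].

Record strictMonoidalCategory := StrictMonoidalCategory {
  smc_cat :> category;
  unitO : obj smc_cat;
  tenO : obj smc_cat -> obj smc_cat -> obj smc_cat;
  tenM : mor smc_cat -> mor smc_cat -> mor smc_cat;
  dom_tenM : forall f g, dom (tenM f g) = tenO (dom f) (dom g);
  cod_tenM : forall f g, cod (tenM f g) = tenO (cod f) (cod g);
  tenM_idm : forall A B, tenM (idm A) (idm B) = idm (tenO A B);
  tenM_comp : forall g f g' f', dom g = cod f -> dom g' = cod f' ->
    tenM (g ∘ f) (g' ∘ f') = (tenM g g' ∘ tenM f f')%mor;
  tenOA : forall X Y Z, tenO (tenO X Y) Z = tenO X (tenO Y Z);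
  tenO1l : forall X, tenO unitO X = X;
  tenO1r : forall X, tenO X unitO = X;
  tenMA : forall f g h, tenM (tenM f g) h = tenM f (tenM g h);
  tenM1l : forall f, tenM (idm unitO) f = f;
  tenM1r : forall f, tenM f (idm unitO) = f }.

Arguments unitO {s}.
Arguments tenO {s}.
Arguments tenM {s}.
Notation "A ⊗ B" := (tenO A%obj B%obj)
  (at level 40, left associativity) : obj_scope.
Notation "f ⊗ g" := (tenM f%mor g%mor)
  (at level 40, left associativity) : mor_scope.

Record braidedCategory := BraidedCategory {
  br_smc :> strictMonoidalCategory;
  braid : obj br_smc -> obj br_smc -> mor br_smc;
  braid_hom : forall X Y, hom (X ⊗ Y) (Y ⊗ X) (braid X Y);
  braid_iso : forall X Y, exists b : mor br_smc,
    [/\ hom (Y ⊗ X) (X ⊗ Y) b,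
        (b ∘ braid X Y)%mor = idm (X ⊗ Y) &
        (braid X Y ∘ b)%mor = idm (Y ⊗ X)];
  braid_natural : forall f g : mor br_smc,
    (braid (cod f) (cod g) ∘ (f ⊗ g))%mor =
    ((g ⊗ f) ∘ braid (dom f) (dom g))%mor;
  braid_tenl : forall X Y Z,
    braid (X ⊗ Y) Z =
    ((braid X Z ⊗ idm Y) ∘ (idm X ⊗ braid Y Z))%mor;
  braid_tenr : forall X Y Z,
    braid X (Y ⊗ Z) =
    ((idm Y ⊗ braid X Z) ∘ (braid X Y ⊗ idm Z))%mor }.

Arguments braid {b}.

(* An object with the four structure morphisms of an algebra and a coalgebra;
   the laws are the predicates below. *)
Record algCoalg (C : braidedCategory) := AlgCoalg {
  car : obj C;
  mul : mor C;
  eta : mor C;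
  Delta : mor C;
  eps : mor C }.

Arguments mul {C}.
Arguments eta {C}.
Arguments Delta {C}.
Arguments eps {C}.

Section AlgebraCoalgebra.
Variable C : braidedCategory.
Implicit Types (A X Y : algCoalg C) (M : obj C) (f : mor C).
Local Open Scope mor_scope.

Definition unitAC : algCoalg C :=
  AlgCoalg unitO (idm unitO) (idm unitO) (idm unitO) (idm unitO).

Record is_algebra A : Prop := {
  mul_hom : hom (car A ⊗ car A) (car A) (mul A);
  eta_hom : hom unitO (car A) (eta A);
  mul_assoc : mul A ∘ (mul A ⊗ idm (car A)) = mul A ∘ (idm (car A) ⊗ mul A);
  mul_unitl : mul A ∘ (eta A ⊗ idm (car A)) = idm (car A);
  mul_unitr : mul A ∘ (idm (car A) ⊗ eta A) = idm (car A) }.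

Record is_coalgebra A : Prop := {
  Delta_hom : hom (car A) (car A ⊗ car A) (Delta A);
  eps_hom : hom (car A) unitO (eps A);
  Delta_coassoc :
    (Delta A ⊗ idm (car A)) ∘ Delta A = (idm (car A) ⊗ Delta A) ∘ Delta A;
  Delta_counitl : (eps A ⊗ idm (car A)) ∘ Delta A = idm (car A);
  Delta_counitr : (idm (car A) ⊗ eps A) ∘ Delta A = idm (car A) }.

Definition algebra_morphism X Y f : Prop :=
  [/\ hom (car X) (car Y) f, f ∘ mul X = mul Y ∘ (f ⊗ f) & f ∘ eta X = eta Y].

Definition coalgebra_morphism X Y f : Prop :=
  [/\ hom (car X) (car Y) f, Delta Y ∘ f = (f ⊗ f) ∘ Delta X &
      eps Y ∘ f = eps X].

Definition alg_coalg_morphism X Y f : Prop :=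
  algebra_morphism X Y f /\ coalgebra_morphism X Y f.

Record is_bialgebra A : Prop := {
  bialg_alg : is_algebra A;
  bialg_coalg : is_coalgebra A;
  bialg_Delta_mul : Delta A ∘ mul A =
    (mul A ⊗ mul A) ∘ (idm (car A) ⊗ braid (car A) (car A) ⊗ idm (car A))
      ∘ (Delta A ⊗ Delta A);
  bialg_eps : algebra_morphism A unitAC (eps A);
  bialg_eta : coalgebra_morphism unitAC A (eta A) }.

Definition left_module A M (act : mor C) : Prop :=
  [/\ hom (car A ⊗ M) M act,
      act ∘ (mul A ⊗ idm M) = act ∘ (idm (car A) ⊗ act) &
      act ∘ (eta A ⊗ idm M) = idm M].

Definition right_module A M (act : mor C) : Prop :=
  [/\ hom (M ⊗ car A) M act,
      act ∘ (act ⊗ idm (car A)) = act ∘ (idm M ⊗ mul A) &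
      act ∘ (idm M ⊗ eta A) = idm M].

Definition left_comodule A M (coact : mor C) : Prop :=
  [/\ hom M (car A ⊗ M) coact,
      (Delta A ⊗ idm M) ∘ coact = (idm (car A) ⊗ coact) ∘ coact &
      (eps A ⊗ idm M) ∘ coact = idm M].

Definition right_comodule A M (coact : mor C) : Prop :=
  [/\ hom M (M ⊗ car A) coact,
      (coact ⊗ idm (car A)) ∘ coact = (idm M ⊗ Delta A) ∘ coact &
      (idm M ⊗ eps A) ∘ coact = idm M].

End AlgebraCoalgebra.

Record hopfData (C : braidedCategory) := HopfData {
  B1 : algCoalg C;
  B2 : algCoalg C;
  mu_l : mor C;
  nu_l : mor C;
  mu_r : mor C;
  nu_r : mor C }.

Section HopfDatum.
Variables (C : braidedCategory) (H : hopfData C).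
Local Open Scope mor_scope.

Local Notation m1 := (mul (B1 H)).
Local Notation m2 := (mul (B2 H)).
Local Notation η1 := (eta (B1 H)).
Local Notation η2 := (eta (B2 H)).
Local Notation Δ1 := (Delta (B1 H)).
Local Notation Δ2 := (Delta (B2 H)).
Local Notation ε1 := (eps (B1 H)).
Local Notation ε2 := (eps (B2 H)).
Local Notation b1 := (car (B1 H)).
Local Notation b2 := (car (B2 H)).
Local Notation id1 := (idm b1).
Local Notation id2 := (idm b2).
Local Notation μl := (mu_l H).
Local Notation νl := (nu_l H).
Local Notation μr := (mu_r H).
Local Notation νr := (nu_r H).
Local Notation Ψ11 := (braid b1 b1).
Local Notation Ψ12 := (braid b1 b2).
Local Notation Ψ21 := (braid b2 b1).
Local Notation Ψ22 := (braid b2 b2).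

Definition phi12 : mor C := (m2 ⊗ m1) ∘ (id2 ⊗ Ψ12 ⊗ id1) ∘ (νl ⊗ νr).
Definition phi21 : mor C := (μl ⊗ μr) ∘ (id2 ⊗ Ψ21 ⊗ id1) ∘ (Δ2 ⊗ Δ1).
Local Notation φ12 := phi12.
Local Notation φ21 := phi21.

Record is_hopf_datum : Prop := {
  hd_alg1 : is_algebra (B1 H);
  hd_alg2 : is_algebra (B2 H);
  hd_coalg1 : is_coalgebra (B1 H);
  hd_coalg2 : is_coalgebra (B2 H);
  hd_eps1 : algebra_morphism (B1 H) (unitAC C) ε1;
  hd_eps2 : algebra_morphism (B2 H) (unitAC C) ε2;
  hd_eta1 : coalgebra_morphism (unitAC C) (B1 H) η1;
  hd_eta2 : coalgebra_morphism (unitAC C) (B2 H) η2;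
  hd_mu_l : left_module (B2 H) b1 μl;
  hd_nu_l : left_comodule (B2 H) b1 νl;
  hd_mu_r : right_module (B1 H) b2 μr;
  hd_nu_r : right_comodule (B1 H) b2 νr;

  hd_mu_r_eta : μr ∘ (η2 ⊗ id1) = η2 ∘ ε1;
  hd_nu_l_eps : (id2 ⊗ ε1) ∘ νl = η2 ∘ ε1;
  hd_eps_mu_r : ε2 ∘ μr = ε2 ⊗ ε1;
  hd_eps_mu_l : ε1 ∘ μl = ε2 ⊗ ε1;
  hd_mu_l_eta : μl ∘ (id2 ⊗ η1) = η1 ∘ ε2;
  hd_nu_r_eps : (ε2 ⊗ id1) ∘ νr = η1 ∘ ε2;
  hd_nu_r_eta : νr ∘ η2 = η2 ⊗ η1;
  hd_nu_l_eta : νl ∘ η1 = η2 ⊗ η1;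

  hd_alg_coalg1 : Δ1 ∘ m1 =
    (m1 ⊗ m1) ∘ (id1 ⊗ μl ⊗ id1 ⊗ id1) ∘ (id1 ⊗ id2 ⊗ Ψ11 ⊗ id1)
      ∘ (id1 ⊗ νl ⊗ id1 ⊗ id1) ∘ (Δ1 ⊗ Δ1);
  hd_alg_coalg2 : Δ2 ∘ m2 =
    (m2 ⊗ m2) ∘ (id2 ⊗ id2 ⊗ μr ⊗ id2) ∘ (id2 ⊗ Ψ22 ⊗ id1 ⊗ id2)
      ∘ (id2 ⊗ id2 ⊗ νr ⊗ id2) ∘ (Δ2 ⊗ Δ2);

  hd_mod_comod : φ12 ∘ φ21 =
    (m2 ⊗ m1) ∘ (μr ⊗ Ψ12 ⊗ μl) ∘ (id2 ⊗ Ψ11 ⊗ Ψ22 ⊗ id1)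
      ∘ (νr ⊗ Ψ21 ⊗ νl) ∘ (Δ2 ⊗ Δ1);

  hd_mod_alg_r : μr ∘ (m2 ⊗ id1) = m2 ∘ (μr ⊗ id2) ∘ (id2 ⊗ φ21);
  hd_mod_alg_l : μl ∘ (id2 ⊗ m1) = m1 ∘ (id1 ⊗ μl) ∘ (φ21 ⊗ id1);

  hd_comod_coalg_r : (Δ2 ⊗ id1) ∘ νr = (id2 ⊗ φ12) ∘ (νr ⊗ id2) ∘ Δ2;
  hd_comod_coalg_l : (id2 ⊗ Δ1) ∘ νl = (φ12 ⊗ id1) ∘ (id1 ⊗ νl) ∘ Δ1;

  hd_mod_coalg_r : Δ2 ∘ μr =
    (m2 ⊗ μr) ∘ (μr ⊗ Ψ22 ⊗ id1) ∘ (id2 ⊗ Ψ21 ⊗ νl) ∘ (Δ2 ⊗ Δ1);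
  hd_mod_coalg_l : Δ1 ∘ μl =
    (μl ⊗ m1) ∘ (id2 ⊗ Ψ11 ⊗ μl) ∘ (νr ⊗ Ψ21 ⊗ id1) ∘ (Δ2 ⊗ Δ1);

  hd_comod_alg_r : νr ∘ m2 =
    (m2 ⊗ m1) ∘ (id2 ⊗ Ψ12 ⊗ μl) ∘ (νr ⊗ Ψ22 ⊗ id1) ∘ (Δ2 ⊗ νr);
  hd_comod_alg_l : νl ∘ m1 =
    (m2 ⊗ m1) ∘ (μr ⊗ Ψ12 ⊗ id1) ∘ (id2 ⊗ Ψ11 ⊗ νl) ∘ (νl ⊗ Δ1) }.

Definition crossB : algCoalg C := {|
  car := b1 ⊗ b2;
  mul := (m1 ⊗ m2) ∘ (id1 ⊗ φ21 ⊗ id2);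
  eta := η1 ⊗ η2;
  Delta := (id1 ⊗ φ12 ⊗ id2) ∘ (Δ1 ⊗ Δ2);
  eps := ε1 ⊗ ε2 |}.

Definition trivial_mu_l : Prop := μl = ε2 ⊗ id1.
Definition trivial_mu_r : Prop := μr = id2 ⊗ ε1.
Definition trivial_nu_l : Prop := νl = η2 ⊗ id1.
Definition trivial_nu_r : Prop := νr = id2 ⊗ η1.

Definition trivalent : Prop :=
  [\/ trivial_mu_l, trivial_mu_r, trivial_nu_l | trivial_nu_r].

Definition Phi_L : mor C := (id1 ⊗ νl) ∘ Δ1.
Definition Phi_R : mor C := (νr ⊗ id2) ∘ Δ2.
Definition Phi_L' : mor C := m1 ∘ (id1 ⊗ μl).
Definition Phi_R' : mor C := m2 ∘ (μr ⊗ id2).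
Definition Phi_P : mor C :=
  (μl ⊗ id1 ⊗ id2 ⊗ id1 ⊗ id2 ⊗ μr)
    ∘ (id2 ⊗ Ψ11 ⊗ id2 ⊗ id1 ⊗ Ψ22 ⊗ id1)
    ∘ (νr ⊗ Ψ21 ⊗ Ψ21 ⊗ νl) ∘ (Δ2 ⊗ Ψ21 ⊗ Δ1) ∘ (Δ2 ⊗ Δ1).
Definition Phi_Q : mor C :=
  (m2 ⊗ m1) ∘ (m2 ⊗ Ψ12 ⊗ m1) ∘ (μr ⊗ Ψ12 ⊗ Ψ12 ⊗ μl)
    ∘ (id2 ⊗ Ψ11 ⊗ id2 ⊗ id1 ⊗ Ψ22 ⊗ id1)
    ∘ (νl ⊗ id1 ⊗ id2 ⊗ id1 ⊗ id2 ⊗ νr).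

Definition Phi (f : mor C) : mor C :=
  (Phi_L' ⊗ Phi_Q ⊗ Phi_R')
    ∘ (id1 ⊗ id2 ⊗ Ψ11 ⊗ f ⊗ Ψ22 ⊗ id1 ⊗ id2)
    ∘ (Phi_L ⊗ Phi_P ⊗ Phi_R).

Definition pi_mor : mor C := (η1 ∘ ε1) ⊗ idm (b2 ⊗ b1) ⊗ (η2 ∘ ε2).

Definition recursive_at (n : nat) : Prop :=
  forall f : mor C, hom (b1 ⊗ b2 ⊗ b1 ⊗ b2) (b1 ⊗ b2 ⊗ b1 ⊗ b2) f ->
  iter n Phi f = iter n Phi (pi_mor ∘ f ∘ pi_mor).

Definition recursive_of_order (n0 : nat) : Prop :=
  recursive_at n0 /\ forall n, recursive_at n -> n0 <= n.

End HopfDatum.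

(* Typing of the composites above: since composition is total, ill-typed terms
   would be accepted by the type checker. *)
Lemma hom_idm (C : category) (A : obj C) : hom A A (idm A).
Proof. by split; [exact: dom_idm | exact: cod_idm]. Qed.

Lemma hom_comp (C : category) (A B B' D : obj C) (g f : mor C) :
  hom A B f -> hom B' D g -> B = B' -> hom A D (g ∘ f).
Proof.
move=> [df cf] [dg cg] eB; rewrite /hom.
have e : dom g = cod f by rewrite dg cf eB.
by rewrite dom_comp // cod_comp.
Qed.

Lemma hom_tenM (C : strictMonoidalCategory) (A B A' B' : obj C) (f g : mor C) :
  hom A B f -> hom A' B' g -> hom (A ⊗ A') (B ⊗ B') (f ⊗ g).
Proof. by move=> [<- <-] [<- <-]; split; [exact: dom_tenM|exact: cod_tenM]. Qed.

Lemma hom_eq (C : category) (A B A' B' : obj C) (f : mor C) :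
  hom A B f -> A = A' -> B = B' -> hom A' B' f.
Proof. by move=> hf <- <-. Qed.

Create HintDb homs.
#[export] Hint Resolve hom_idm braid_hom : homs.

Ltac hom_infer :=
  lazymatch goal with
  | |- hom _ _ (comp _ _) =>
      eapply hom_comp; [hom_infer | hom_infer | by rewrite ?tenOA ?tenO1l ?tenO1r]
  | |- hom _ _ (tenM _ _) => eapply hom_tenM; [hom_infer | hom_infer]
  | |- _ => solve [eauto with homs]
  end.
Ltac hom_check :=
  eapply hom_eq; [hom_infer | by rewrite ?tenOA ?tenO1l ?tenO1r
                 | by rewrite ?tenOA ?tenO1l ?tenO1r].

Section Typing.
Variables (C : braidedCategory) (H : hopfData C).
Hypothesis HH : is_hopf_datum H.
Local Notation b1 := (car (B1 H)).
Local Notation b2 := (car (B2 H)).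

Let hm1 := mul_hom (hd_alg1 HH).
Let hm2 := mul_hom (hd_alg2 HH).
Let he1 := eta_hom (hd_alg1 HH).
Let he2 := eta_hom (hd_alg2 HH).
Let hD1 := Delta_hom (hd_coalg1 HH).
Let hD2 := Delta_hom (hd_coalg2 HH).
Let hc1 := eps_hom (hd_coalg1 HH).
Let hc2 := eps_hom (hd_coalg2 HH).
Let hmul : hom (b2 ⊗ b1) b1 (mu_l H). Proof. by case: (hd_mu_l HH). Qed.
Let hmur : hom (b2 ⊗ b1) b2 (mu_r H). Proof. by case: (hd_mu_r HH). Qed.
Let hnul : hom b1 (b2 ⊗ b1) (nu_l H). Proof. by case: (hd_nu_l HH). Qed.
Let hnur : hom b2 (b2 ⊗ b1) (nu_r H). Proof. by case: (hd_nu_r HH). Qed.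
#[local] Hint Resolve hm1 hm2 he1 he2 hD1 hD2 hc1 hc2 hmul hmur hnul hnur : homs.

Lemma hom_phi12 : hom (b1 ⊗ b2) (b2 ⊗ b1) (phi12 H).
Proof. rewrite /phi12; hom_check. Qed.

Lemma hom_phi21 : hom (b2 ⊗ b1) (b1 ⊗ b2) (phi21 H).
Proof. rewrite /phi21; hom_check. Qed.

#[local] Hint Resolve hom_phi12 hom_phi21 : homs.

Lemma hom_crossB_mul :
  hom (b1 ⊗ b2 ⊗ (b1 ⊗ b2)) (b1 ⊗ b2) (mul (crossB H)).
Proof. rewrite /=; hom_check. Qed.

Lemma hom_crossB_Delta :
  hom (b1 ⊗ b2) (b1 ⊗ b2 ⊗ (b1 ⊗ b2)) (Delta (crossB H)).
Proof. rewrite /=; hom_check. Qed.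

Lemma hom_Phi_P :
  hom (b2 ⊗ b1) (b1 ⊗ b1 ⊗ b2 ⊗ b1 ⊗ b2 ⊗ b2) (Phi_P H).
Proof. rewrite /Phi_P; hom_check. Qed.

Lemma hom_Phi_Q :
  hom (b1 ⊗ b1 ⊗ b2 ⊗ b1 ⊗ b2 ⊗ b2) (b2 ⊗ b1) (Phi_Q H).
Proof. rewrite /Phi_Q; hom_check. Qed.

Lemma hom_Phi (f : mor C) :
  hom (b1 ⊗ b2 ⊗ b1 ⊗ b2) (b1 ⊗ b2 ⊗ b1 ⊗ b2) f ->
  hom (b1 ⊗ b2 ⊗ b1 ⊗ b2) (b1 ⊗ b2 ⊗ b1 ⊗ b2) (Phi H f).
Proof.
by move=> hf; rewrite /Phi /Phi_L /Phi_L' /Phi_R /Phi_R' /Phi_P /Phi_Q; hom_check.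
Qed.

Lemma hom_pi_mor :
  hom (b1 ⊗ b2 ⊗ b1 ⊗ b2) (b1 ⊗ b2 ⊗ b1 ⊗ b2) (pi_mor H).
Proof. rewrite /pi_mor; hom_check. Qed.

End Typing.

(* Main.v *)
Require Import Defs.
From mathcomp Require Import all_boot zify.
From Stdlib Require Import Classical.
Import Defs.

Set Implicit Arguments.
Unset Strict Implicit.
Unset Printing Implicit Defensive.

(* Every morphism below is a string diagram: a list of generators applied at given
   positions.  Lists related by interchange, by naturality of the braiding or by
   known equations denote the same morphism, and a verified rewriting function on
   such lists carries out the diagrammatic calculations.

   For any Hopf datum, B is generated by its subalgebras B_1 and B_2, and Δ_B is
   multiplicative on each of them and on the products of B_1 by B_2.  So B is a
   bialgebra as soon as Δ_B is multiplicative on the products of B_2 by B_1, which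
   holds when one of the (co)actions is trivial.

   Write π = π_1 π_4, where π_1 and π_4 act on the outer factors B_1 and B_2.  If,
   for instance, μ_l is trivial, then Φ(f) = Φ(π_4 f π_1), and π_4 Φ(f) π_1 only
   depends on π f π; hence Φ^2(f) = Φ^2(π f π). *)

(** * String diagrams *)

(* A string diagram is read from its domain on: the slice (k, g) applies the
   generator g to the strands k, k + 1, ... and is the identity elsewhere.  The
   generator [inl n] is the n-th entry of a table of morphisms with arities [ar],
   and [inr (a, b)] is the braiding of the objects a and b. *)
Definition word := seq nat.
Definition gen := (nat + nat * nat)%type.
Definition slice := (nat * gen)%type.
Definition diag := seq slice.

Inductive otm := OUnit | OAtom of nat | OTen of otm & otm.
Inductive tm := TBox of nat | TBr of otm & otm | TId of otm
  | TComp of tm & tm | TTen of tm & tm.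

Definition shift (k : nat) : diag -> diag := map (fun s => (k + s.1, s.2)).

(** [cross1] and [cross] unfold the hexagon identities: the braiding of two words becomes elementary
    crossings, the last strand of [u] passing [v] first. *)
Fixpoint cross1 (a : nat) (v : word) : diag :=
  if v is b :: v' then (0, inr (a, b)) :: shift 1 (cross1 a v') else [::].

Fixpoint cross (u v : word) : diag :=
  if u is a :: u' then shift 1 (cross u' v) ++ cross1 a v else [::].

Fixpoint oword (o : otm) : word :=
  match o with
  | OUnit => [::]
  | OAtom a => [:: a]
  | OTen o1 o2 => oword o1 ++ oword o2
  end.

Lemma shift0 d : shift 0 d = d.
Proof. by rewrite -[RHS]map_id; apply: eq_map => -[]. Qed.

Section Syntax.
Variable ar : seq (word * word).

Definition gdom (g : gen) : word :=
  match g with inl n => (nth ([::], [::]) ar n).1 | inr p => [:: p.1; p.2] end.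

Definition gcod (g : gen) : word :=
  match g with inl n => (nth ([::], [::]) ar n).2 | inr p => [:: p.2; p.1] end.

Definition fits (w : word) (s : slice) : bool :=
  (s.1 <= size w) && prefix (gdom s.2) (drop s.1 w).

Definition after (w : word) (s : slice) : word :=
  take s.1 w ++ gcod s.2 ++ drop (s.1 + size (gdom s.2)) w.

Fixpoint wt (w : word) (d : diag) : bool :=
  if d is s :: d' then fits w s && wt (after w s) d' else true.

Definition endw : word -> diag -> word := foldl after.

Fixpoint tdom (t : tm) : word :=
  match t with
  | TBox n => gdom (inl n)
  | TBr o1 o2 => oword o1 ++ oword o2
  | TId o => oword o
  | TComp _ f => tdom f
  | TTen f g => tdom f ++ tdom g
  end.

Fixpoint tcod (t : tm) : word :=
  match t with
  | TBox n => gcod (inl n)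
  | TBr o1 o2 => oword o2 ++ oword o1
  | TId o => oword o
  | TComp g _ => tcod g
  | TTen f g => tcod f ++ tcod g
  end.

Fixpoint twt (t : tm) : bool :=
  match t with
  | TComp g f => [&& twt f, twt g & tdom g == tcod f]
  | TTen f g => twt f && twt g
  | _ => true
  end.

Fixpoint flat (t : tm) : diag :=
  match t with
  | TBox n => [:: (0, inl n)]
  | TBr o1 o2 => cross (oword o1) (oword o2)
  | TId o => [::]
  | TComp g f => flat f ++ flat g
  | TTen f g => flat f ++ shift (size (tcod f)) (flat g)
  end.

Lemma fitsP w s : fits w s ->
  exists u v, w = u ++ gdom s.2 ++ v /\ s.1 = size u.
Proof.
case/andP=> le_s /prefixP[v ev]; exists (take s.1 w), v.
by rewrite -ev cat_take_drop size_takel.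
Qed.

Lemma fits_cat u g v : fits (u ++ gdom g ++ v) (size u, g).
Proof.
by rewrite /fits /= drop_size_cat // prefix_prefix size_cat leq_addr.
Qed.

Lemma after_cat u g v : after (u ++ gdom g ++ v) (size u, g) = u ++ gcod g ++ v.
Proof.
rewrite /after /= take_size_cat // [u ++ gdom g ++ v]catA.
by rewrite drop_size_cat ?size_cat.
Qed.

Lemma wt_cat w d d' : wt w (d ++ d') = wt w d && wt (endw w d) d'.
Proof. by elim: d w => //= s d IHd w; rewrite IHd andbA. Qed.

Lemma endw_cat w d d' : endw w (d ++ d') = endw (endw w d) d'.
Proof. exact: foldl_cat. Qed.

Lemma wt_shift u w v d : wt w d ->
  wt (u ++ w ++ v) (shift (size u) d)
  /\ endw (u ++ w ++ v) (shift (size u) d) = u ++ endw w d ++ v.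
Proof.
elim: d w => //= -[k g] d IHd w /andP[/fitsP[x [y [/= -> ->]]]].
rewrite after_cat => /IHd[wtd endd].
have -> : u ++ (x ++ gdom g ++ y) ++ v = (u ++ x) ++ gdom g ++ y ++ v.
  by rewrite !catA.
rewrite /= -size_cat after_cat fits_cat.
have -> : (u ++ x) ++ gcod g ++ y ++ v = u ++ (x ++ gcod g ++ y) ++ v.
  by rewrite !catA.
by [].
Qed.

Lemma cat_inv_le (T : Type) (a b c d : seq T) : a ++ b = c ++ d ->
  size a <= size c -> exists e, c = a ++ e /\ b = e ++ d.
Proof.
elim: a c => [|x a IHa] [|y c] //=.
- by move=> -> _; exists [::].
- by move=> -> _; exists (y :: c).
case=> <- /IHa H /H[e [-> ->]]; by exists e.
Qed.

(** The interchange law for slices touching disjoint strands. The right-hand one has its position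
    corrected by the change of arity of the other. *)
Definition swap2 (s1 s2 : slice) : option (slice * slice) :=
  if s1.1 + size (gcod s1.2) <= s2.1 then
    Some ((s2.1 - size (gcod s1.2) + size (gdom s1.2), s2.2), s1)
  else if s2.1 + size (gdom s2.2) <= s1.1 then
    Some (s2, (s1.1 - size (gdom s2.2) + size (gcod s2.2), s1.2))
  else None.

Fixpoint swap (p : nat) (d : diag) : option diag :=
  match p, d with
  | 0, s1 :: s2 :: d' =>
      if swap2 s1 s2 is Some (t1, t2) then Some (t1 :: t2 :: d') else None
  | p'.+1, s :: d' => omap (cons s) (swap p' d')
  | _, _ => None
  end.

Lemma swap2P w s1 s2 t1 t2 : fits w s1 -> fits (after w s1) s2 ->
  swap2 s1 s2 = Some (t1, t2) ->
  exists u x v y z,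
    [/\ s1.2 = x, s2.2 = y &
     (w = u ++ gdom x ++ v ++ gdom y ++ z /\
      [/\ s1.1 = size u, s2.1 = size (u ++ gcod x ++ v),
         t1 = (size (u ++ gdom x ++ v), y) & t2 = (size u, x)])
   \/ (w = u ++ gdom y ++ v ++ gdom x ++ z /\
      [/\ s1.1 = size (u ++ gdom y ++ v), s2.1 = size u,
         t1 = (size u, y) & t2 = (size (u ++ gcod y ++ v), x)])].
Proof.
case: s1 s2 => [k1 x] [k2 y] /fitsP[u [r /= [-> ->]]].
rewrite after_cat => /fitsP[u' [z /= [e ->]]]; rewrite /swap2 /=.
case: leqP => [le12 [<- <-]|_].
  have [||v [eu er]] := @cat_inv_le _ (u ++ gcod x) r u' (gdom y ++ z).
  - by rewrite -catA.
  - by rewrite size_cat.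
  exists u, x, v, y, z; split=> //; left; rewrite er; split=> //.
  by split=> //; rewrite eu !size_cat ?addnA //; congr (_, _); lia.
case: leqP => // le21 [<- <-].
have [||v [eu er]] := @cat_inv_le _ (u' ++ gdom y) z u (gcod x ++ r).
- by rewrite -catA e.
- by rewrite size_cat.
exists u', x, v, y, r; split=> //; right; rewrite eu -!catA; split=> //.
by split=> //; congr (_, _); rewrite !size_cat; lia.
Qed.

End Syntax.

(** * Typed composition and tensor products; the braiding with the unit *)

Section HomLemmas.
Variable C : strictMonoidalCategory.
Implicit Types (X Y : obj C) (f g : mor C).
Local Open Scope mor_scope.

Lemma hom_compA X Y Z T (h g f : mor C) : hom X Y f -> hom Y Z g -> hom Z T h ->
  h ∘ (g ∘ f) = (h ∘ g) ∘ f.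
Proof. by move=> [_ cf] [dg cg] [dh _]; apply: comp_assoc; congruence. Qed.

Lemma hom_comp1l X Y (f : mor C) : hom X Y f -> idm Y ∘ f = f.
Proof. by move=> [_ <-]; apply: comp_idl. Qed.

Lemma hom_comp1r X Y (f : mor C) : hom X Y f -> f ∘ idm X = f.
Proof. by move=> [<- _]; apply: comp_idr. Qed.

Lemma hom_comp' X Y Z (g f : mor C) : hom X Y f -> hom Y Z g -> hom X Z (g ∘ f).
Proof. by move=> hf hg; apply: hom_comp hf hg erefl. Qed.

Lemma hom_tenM_comp X Y Z X' Y' Z' (f g f' g' : mor C) :
  hom X Y f -> hom Y Z g -> hom X' Y' f' -> hom Y' Z' g' ->
  (g ∘ f) ⊗ (g' ∘ f') = (g ⊗ g') ∘ (f ⊗ f').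
Proof.
by move=> [_ cf] [dg _] [_ cf'] [dg' _]; apply: tenM_comp; congruence.
Qed.

Lemma ten_compl X Y X' Y' (f f' : mor C) : hom X Y f -> hom X' Y' f' ->
  (f ⊗ idm Y') ∘ (idm X ⊗ f') = f ⊗ f'.
Proof.
move=> hf hf'; rewrite -(hom_tenM_comp (hom_idm X) hf hf' (hom_idm Y')).
by rewrite (hom_comp1r hf) (hom_comp1l hf').
Qed.

Lemma ten_compr X Y X' Y' (f f' : mor C) : hom X Y f -> hom X' Y' f' ->
  (idm Y ⊗ f') ∘ (f ⊗ idm X') = f ⊗ f'.
Proof.
move=> hf hf'; rewrite -(hom_tenM_comp hf (hom_idm Y) (hom_idm X') hf').
by rewrite (hom_comp1l hf) (hom_comp1r hf').
Qed.

End HomLemmas.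

Section BraidUnit.
Variable C : braidedCategory.
Implicit Types X Y : obj C.

(* The hexagon at I makes Ψ_{I,X} idempotent, hence the identity. *)
Lemma braid_unitl X : braid unitO X = idm X.
Proof.
have [b [hb bl _]] := braid_iso unitO X; rewrite tenO1l tenO1r in hb bl.
have hB := braid_hom unitO X; rewrite tenO1l tenO1r in hB.
have := braid_tenl unitO unitO X; rewrite !tenO1l tenM1l tenM1r => e.
by rewrite -[LHS](hom_comp1l hB) -bl -(hom_compA hB hB hb) -e.
Qed.

Lemma braid_unitr X : braid X unitO = idm X.
Proof.
have [b [hb bl _]] := braid_iso X unitO; rewrite tenO1l tenO1r in hb bl.
have hB := braid_hom X unitO; rewrite tenO1l tenO1r in hB.
have := braid_tenr X unitO unitO; rewrite !tenO1r tenM1l tenM1r => e.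
by rewrite -[LHS](hom_comp1l hB) -bl -(hom_compA hB hB hb) -e.
Qed.

End BraidUnit.

(** * Interpretation of diagrams in the category *)

Section Semantics.
Variables (C : braidedCategory) (ob : seq (obj C)) (ar : seq (word * word)).
Variable bx : seq (mor C).
Local Open Scope mor_scope.

Definition wobj (w : word) : obj C :=
  foldr (fun a => tenO (nth unitO ob a)) unitO w.

Definition gmor (g : gen) : mor C :=
  match g with
  | inl n => nth (idm unitO) bx n
  | inr (a, b) => braid (nth unitO ob a) (nth unitO ob b)
  end.

Definition sden (w : word) (s : slice) : mor C :=
  idm (wobj (take s.1 w)) ⊗ gmor s.2
    ⊗ idm (wobj (drop (s.1 + size (gdom ar s.2)) w)).

Fixpoint dden (w : word) (d : diag) : mor C :=
  if d is s :: d' then dden (after ar w s) d' ∘ sden w s else idm (wobj w).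

Fixpoint oobj (o : otm) : obj C :=
  match o with
  | OUnit => unitO
  | OAtom a => nth unitO ob a
  | OTen o1 o2 => tenO (oobj o1) (oobj o2)
  end.

Fixpoint eval (t : tm) : mor C :=
  match t with
  | TBox n => nth (idm unitO) bx n
  | TBr o1 o2 => braid (oobj o1) (oobj o2)
  | TId o => idm (oobj o)
  | TComp g f => eval g ∘ eval f
  | TTen f g => eval f ⊗ eval g
  end.

Lemma wobj_cat u v : wobj (u ++ v) = tenO (wobj u) (wobj v).
Proof. by elim: u => [|a u IHu] /=; rewrite ?tenO1l // IHu tenOA. Qed.

Lemma wobj_oword o : wobj (oword o) = oobj o.
Proof.
by elim: o => //= [a|o1 <- o2 <-]; rewrite ?tenO1r // wobj_cat.
Qed.

Definition well_formed := forall n, n < size ar ->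
  hom (wobj (gdom ar (inl n))) (wobj (gcod ar (inl n))) (gmor (inl n)).

Hypothesis szP : size ar = size bx.
Hypothesis bxP : well_formed.

Lemma gmorP g : hom (wobj (gdom ar g)) (wobj (gcod ar g)) (gmor g).
Proof.
case: g => [n|[a b]] /=.
  have [/bxP //|le_n] := ltnP n (size ar).
  by rewrite !nth_default -?szP //; apply: hom_idm.
by rewrite !tenO1r; apply: braid_hom.
Qed.

Lemma idmP u : hom (wobj u) (wobj u) (idm (wobj u)).
Proof. exact: hom_idm. Qed.

Lemma sden_cat u g v : sden (u ++ gdom ar g ++ v) (size u, g) =
  idm (wobj u) ⊗ gmor g ⊗ idm (wobj v).
Proof.
rewrite /sden /= take_size_cat // [u ++ gdom ar g ++ v]catA drop_size_cat //.
by rewrite size_cat.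
Qed.

Lemma sden_hom w s : fits ar w s -> hom (wobj w) (wobj (after ar w s)) (sden w s).
Proof.
case: s => k g /fitsP[u [v [/= -> ->]]]; rewrite after_cat sden_cat.
rewrite !wobj_cat -!tenOA; apply: hom_tenM (idmP v).
exact: hom_tenM (idmP u) (gmorP g).
Qed.

Lemma dden_hom w d : wt ar w d -> hom (wobj w) (wobj (endw ar w d)) (dden w d).
Proof.
elim: d w => [|s d IHd] w /=; first by move=> _; apply: idmP.
by case/andP=> /sden_hom hs /IHd; apply: hom_comp'.
Qed.

Lemma dden_cat w d d' : wt ar w (d ++ d') ->
  dden w (d ++ d') = dden (endw ar w d) d' ∘ dden w d.
Proof.
elim: d w => [|s d IHd] w /=.
  by move=> /dden_hom hd; rewrite (hom_comp1r hd).
case/andP=> fs wd; rewrite IHd //; move: wd; rewrite wt_cat => /andP[wd wd'].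
by rewrite (hom_compA (sden_hom fs) (dden_hom wd) (dden_hom wd')).
Qed.

Lemma sden_shift u w v s : fits ar w s ->
  sden (u ++ w ++ v) (size u + s.1, s.2) =
  idm (wobj u) ⊗ sden w s ⊗ idm (wobj v).
Proof.
case: s => k g /fitsP[x [y [/= -> ->]]]; rewrite sden_cat -size_cat.
have -> : u ++ (x ++ gdom ar g ++ y) ++ v = (u ++ x) ++ gdom ar g ++ y ++ v.
  by rewrite !catA.
by rewrite sden_cat !wobj_cat -!tenM_idm !tenMA.
Qed.

Lemma dden_shift u w v d : wt ar w d ->
  dden (u ++ w ++ v) (shift (size u) d) =
  idm (wobj u) ⊗ dden w d ⊗ idm (wobj v).
Proof.
elim: d w => [|s d IHd] w /=; first by rewrite !tenM_idm !wobj_cat tenOA.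
case/andP=> fs wd; rewrite sden_shift //.
have [_ /= ->] := wt_shift u v (d := [:: s]) (w := w) (ar := ar) ltac:(by rewrite /= fs).
have hs := sden_hom fs; have hd := dden_hom wd.
rewrite IHd // -(hom_tenM_comp (hom_tenM (idmP u) hs) (hom_tenM (idmP u) hd)
  (idmP v) (idmP v)).
by rewrite -(hom_tenM_comp (idmP u) (idmP u) hs hd) !(hom_comp1r (idmP _)).
Qed.

(** Well-typedness of the source is a premise, so steps chain and only the first diagram has to be
    type-checked. *)
Definition refines (w : word) (d d' : diag) : Prop := wt ar w d ->
  [/\ wt ar w d', endw ar w d' = endw ar w d & dden w d' = dden w d].

Lemma refines_trans w d1 d2 d3 :
  refines w d1 d2 -> refines w d2 d3 -> refines w d1 d3.
Proof. by move=> r12 r23 /r12[/r23[w3 -> ->] -> ->]. Qed.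

Lemma refines_cat w p d d' q : refines (endw ar w p) d d' ->
  refines w (p ++ d ++ q) (p ++ d' ++ q).
Proof.
move=> r wpdq; move: (wpdq); rewrite wt_cat => /andP[wp wdq].
move: (wdq); rewrite wt_cat => /andP[/r[wd' ed' dd'] wq].
have wd'q : wt ar (endw ar w p) (d' ++ q) by rewrite wt_cat wd' ed'.
have wpd'q : wt ar w (p ++ d' ++ q) by rewrite wt_cat wp.
by split; rewrite ?endw_cat ?ed' // !dden_cat // ed' dd'.
Qed.

Lemma dden_ten w1 w2 d1 d2 : wt ar w1 d1 -> wt ar w2 d2 ->
  [/\ wt ar (w1 ++ w2) (d1 ++ shift (size (endw ar w1 d1)) d2),
      endw ar (w1 ++ w2) (d1 ++ shift (size (endw ar w1 d1)) d2)
        = endw ar w1 d1 ++ endw ar w2 d2 &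
      dden (w1 ++ w2) (d1 ++ shift (size (endw ar w1 d1)) d2)
        = dden w1 d1 ⊗ dden w2 d2].
Proof.
move=> wd1 wd2; have [] := wt_shift [::] w2 wd1.
have [] := wt_shift (endw ar w1 d1) [::] wd2; rewrite !shift0 !cats0 /=.
move=> t2 e2 t1 e1.
have wd : wt ar (w1 ++ w2) (d1 ++ shift (size (endw ar w1 d1)) d2).
  by rewrite wt_cat t1 e1.
split; rewrite ?endw_cat ?e1 // dden_cat // e1.
have := dden_shift [::] w2 wd1; rewrite shift0 tenM1l /= => ->.
have := dden_shift (endw ar w1 d1) [::] wd2; rewrite cats0 tenM1r /= => ->.
exact: ten_compr (dden_hom wd1) (dden_hom wd2).
Qed.

(** The tensor product with its right factor performed first; comparison with [dden_ten] yields the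
    interchange law. *)
Lemma dden_ten' w1 w2 d1 d2 : wt ar w1 d1 -> wt ar w2 d2 ->
  [/\ wt ar (w1 ++ w2) (shift (size w1) d2 ++ d1),
      endw ar (w1 ++ w2) (shift (size w1) d2 ++ d1)
        = endw ar w1 d1 ++ endw ar w2 d2 &
      dden (w1 ++ w2) (shift (size w1) d2 ++ d1)
        = dden w1 d1 ⊗ dden w2 d2].
Proof.
move=> wd1 wd2; have [] := wt_shift [::] (endw ar w2 d2) wd1.
have [] := wt_shift w1 [::] wd2; rewrite !shift0 !cats0 /=.
move=> t2 e2 t1 e1; have wd : wt ar (w1 ++ w2) (shift (size w1) d2 ++ d1).
  by rewrite wt_cat t2 e2.
split; rewrite ?endw_cat ?e2 // dden_cat // e2.
have := dden_shift [::] (endw ar w2 d2) wd1; rewrite shift0 tenM1l /= => ->.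
have := dden_shift w1 [::] wd2; rewrite cats0 tenM1r /= => ->.
exact: ten_compl (dden_hom wd1) (dden_hom wd2).
Qed.

Lemma wt1_cat u g v : wt ar (u ++ gdom ar g ++ v) [:: (size u, g)].
Proof. by rewrite /= fits_cat. Qed.

Lemma refines_swap2 w s1 s2 t1 t2 : swap2 ar s1 s2 = Some (t1, t2) ->
  refines w [:: s1; s2] [:: t1; t2].
Proof.
move=> sw; rewrite /refines /= andbT => /andP[f1 f2].
have [u [x [v [y [z [e1 e2 H]]]]]] := swap2P f1 f2 sw.
case: s1 s2 e1 e2 {sw} f1 f2 H => k1 x' [k2 y'] /= -> -> {x' y'} f1 f2.
(* The word is cut just after the left generator, so that both orders are tensor products of two
   one-slice diagrams. *)
have cat1 a b c d e : a ++ b ++ c ++ d ++ e = (a ++ b) ++ c ++ d ++ e :> word.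
  by rewrite !catA.
case=> -[ew [? ? -> ->]] {f1 f2}; subst k1 k2 w; rewrite !cat1.
  have := dden_ten (wt1_cat u x [::]) (wt1_cat v y z).
  have := dden_ten' (wt1_cat u x [::]) (wt1_cat v y z).
  rewrite /endw /= !after_cat !cats0 -!size_cat -!catA.
  by rewrite andbT => -[-> -> ->] [_ -> ->].
have := dden_ten (wt1_cat u y [::]) (wt1_cat v x z).
have := dden_ten' (wt1_cat u y [::]) (wt1_cat v x z).
rewrite /endw /= !after_cat !cats0 -!size_cat -!catA.
by rewrite !andbT => -[_ -> ->] [-> -> ->].
Qed.

Lemma refines_swap p w d d' : swap ar p d = Some d' -> refines w d d'.
Proof.
elim: p w d d' => [|p IHp] w [|s1 d] d' //=.
  case: d => [|s2 d] //; case E: swap2 => [[t1 t2]|] // [<-].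
  exact: (@refines_cat w [::] [:: s1; s2] [:: t1; t2]) (refines_swap2 E).
case E: (swap ar p d) => [e|] //= [<-].
have := @refines_cat w [:: s1] d e [::]; rewrite !cats0; apply; exact: IHp.
Qed.

Lemma cross1P a v : wt ar (a :: v) (cross1 a v) /\
  endw ar (a :: v) (cross1 a v) = rcons v a.
Proof.
elim: v => //= b v [wv ev]; have [] := wt_shift [:: b] [::] wv.
by rewrite /= /after /fits /= !cats0 ?drop0 ev prefix0s !eqxx => -> ->.
Qed.

Lemma cross1_den a v :
  dden (a :: v) (cross1 a v) = braid (nth unitO ob a) (wobj v).
Proof.
elim: v => [|b v IHv] /=; first by rewrite braid_unitr tenO1r.
have [wv ev] := cross1P a v.
have := dden_shift [:: b] [::] wv; rewrite /after /sden /= !drop0 !cats0 => ->.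
by rewrite braid_tenr tenM1l tenM1r tenO1r IHv.
Qed.

Lemma crossP u v : wt ar (u ++ v) (cross u v) /\
  endw ar (u ++ v) (cross u v) = v ++ u.
Proof.
elim: u => [|a u [wu eu]] /=; first by rewrite cats0.
have [] := wt_shift [:: a] [::] wu; rewrite /= !cats0 => tu e.
have [wa ea] := cross1P a v; have [] := wt_shift [::] u wa.
by rewrite shift0 /= wt_cat endw_cat tu e eu ea cat_rcons /= => -> ->.
Qed.

Lemma cross_den u v : dden (u ++ v) (cross u v) = braid (wobj u) (wobj v).
Proof.
elim: u => [|a u IHu] /=; first by rewrite braid_unitl.
have [wau _] := crossP (a :: u) v; rewrite dden_cat //.
have [wu eu] := crossP u v; have := wt_shift [:: a] [::] wu.
rewrite /= !cats0 eu => -[_ ->].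
have := dden_shift [:: a] [::] wu; rewrite cats0 /= => ->.
have [wa ea] := cross1P a v.
have := dden_shift [::] u wa; rewrite shift0 /= => ->.
by rewrite tenM1l tenM1r cross1_den tenO1r IHu braid_tenl.
Qed.

Lemma flatP t : twt ar t ->
  [/\ wt ar (tdom ar t) (flat ar t),
      endw ar (tdom ar t) (flat ar t) = tcod ar t &
      dden (tdom ar t) (flat ar t) = eval t].
Proof.
elim: t => [n|o1 o2|o|g IHg f IHf|f IHf g IHg] /=.
- move=> _; have := wt1_cat [::] (inl n) [::].
  have := after_cat ar [::] (inl n) [::]; have := sden_cat [::] (inl n) [::].
  have := gmorP (inl n); rewrite /= !cats0 => hn -> -> ->.
  by split=> //; rewrite tenM1l tenM1r (hom_comp1l hn).
- move=> _; have [w e] := crossP (oword o1) (oword o2).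
  by split; rewrite // cross_den !wobj_oword.
- by move=> _; rewrite wobj_oword.
- case/and3P=> /IHf[wf ef df] /IHg[wg eg dg] /eqP e.
  have wfg : wt ar (tdom ar f) (flat ar f ++ flat ar g).
    by rewrite wt_cat wf ef -e.
  by split; rewrite // ?endw_cat ?dden_cat // ef -e // df dg.
- case/andP=> /IHf[wf ef df] /IHg[wg eg dg].
  by have := dden_ten wf wg; rewrite ef eg df dg.
Qed.

End Semantics.

(** * Rewriting of diagrams *)

(* [Nat fwd b g a] slides the generator g through a strand a, which is on the
   right of the codomain of g unless [b] holds; [fwd] turns "g, then crossing"
   into "crossing, then g". *)
Inductive rule := Eqn of tm & tm | Nat of bool & bool & gen & nat.

Section Search.
Variable ar : seq (word * word).

Definition nat_sides (b : bool) (g : gen) (a : nat) : word * (diag * diag) :=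
  if b then
    (a :: gdom ar g, ((1, g) :: cross [:: a] (gcod ar g),
                      cross [:: a] (gdom ar g) ++ [:: (0, g)]))
  else
    (gdom ar g ++ [:: a], ((0, g) :: cross (gcod ar g) [:: a],
                           cross (gdom ar g) [:: a] ++ [:: (1, g)])).

(* The orientation of the naturality rules used in normal forms: comultiplications
   and coactions move before the crossings, multiplications and actions after
   them, and the crossings of units and counits disappear. *)
Definition nat_lr (g : gen) : bool :=
  (size (gdom ar g) == 0) || (0 < size (gcod ar g) <= size (gdom ar g)).

Definition sides (r : rule) : word * (diag * diag) :=
  match r with
  | Eqn l r => (tdom ar l, (flat ar l, flat ar r))
  | Nat fwd b g a =>
      let: (w, (l, r)) := nat_sides b g a in
      if fwd then (w, (l, r)) else (w, (r, l))
  end.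

Definition apply_at (r : rule) (p k : nat) (w : word) (d : diag) : option diag :=
  let: (w0, (l, r)) := sides r in
  let w' := endw ar w (take p d) in
  if [&& take (size l) (drop p d) == shift k l, k <= size w'
       & prefix w0 (drop k w')]
  then Some (take p d ++ shift k r ++ drop (p + size l) d) else None.

Fixpoint swaps (ps : seq nat) (d : diag) : option diag :=
  if ps is p :: ps' then obind (swaps ps') (swap ar p d) else Some d.

(* Searching for an occurrence of a rule modulo interchange: a slice is brought
   next to the slices matched so far, together with those slices in between on
   which it depends ([gather]); the latter are then moved before the match
   ([lift]).  Nothing has to be proved about the search, which only returns a list
   of interchanges to be carried out by [swaps]. *)
Fixpoint gather (m q0 c : nat) (d : diag) (acc : seq nat) : nat * diag * seq nat :=
  if m is m'.+1 then
    let ps := iota (q0 + m') (c - (q0 + m')) in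
    if swaps ps d is Some d' then gather m' q0 c.-1 d' (acc ++ ps)
    else gather m' q0 c d acc
  else (c, d, acc).

Fixpoint lift (n p q : nat) (d : diag) (acc : seq nat) : option (diag * seq nat) :=
  if n is n'.+1 then
    let ps := rev (iota p (q - p)) in
    if swaps ps d is Some d' then lift n' p.+1 q.+1 d' (acc ++ ps) else None
  else Some (d, acc).

Fixpoint pick_first (A B : Type) (f : A -> option B) (s : seq A) : option B :=
  if s is x :: s' then (if f x is Some y then Some y else pick_first f s') else None.

Definition null_slice : slice := (0, inl 0).

Fixpoint find_rest (h : nat) (ls : diag) (p q : nat) (d : diag) (acc : seq nat) :
    option (seq nat * nat * nat) :=
  if ls is e :: ls' then
    pick_first (fun j =>
      if (nth null_slice d j).2 == e.2 then
        let: (c, d1, acc1) := gather (j - q) q j d acc in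
        if lift (c - q) p q d1 acc1 is Some (d2, acc2) then
          let p' := p + (c - q) in let q' := q + (c - q) in
          (* Heights are compared relative to the first matched slice, additively to avoid truncated
             subtraction. *)
          if (nth null_slice d2 q').1 + h == e.1 + (nth null_slice d2 p').1
          then find_rest h ls' p' q'.+1 d2 acc2 else None
        else None
      else None) (iota q (size d - q))
  else Some (acc, p, (nth null_slice d p).1 - h).

Definition rewrite_at (r : rule) (w : word) (d : diag) (i : nat) : option diag :=
  if (sides r).2.1 is e :: ls then
    if ((nth null_slice d i).2 == e.2) && (e.1 <= (nth null_slice d i).1) then
      if find_rest e.1 ls i i.+1 d [::] is Some (ps, p, k) then
        obind (apply_at r p k w) (swaps ps d)
      else None
    else None
  else None.

(** The default [d] keeps the function sound when there is no such match; the tactics detect this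
    case by comparing input and output. *)
Definition rewrite_nth (n : nat) (r : rule) (w : word) (d : diag) : diag :=
  nth d (pmap (rewrite_at r w d) (iota 0 (size d))) n.

Definition rewrite_first (rs : seq rule) (w : word) (d : diag) : option diag :=
  pick_first (fun r => pick_first (rewrite_at r w d) (iota 0 (size d))) rs.

Fixpoint norm (fuel : nat) (rs : seq rule) (w : word) (d : diag) : diag :=
  if fuel is n.+1 then
    if rewrite_first rs w d is Some d' then norm n rs w d' else d
  else d.

(** Equality modulo interchange, by selection sort: each slice of [d1] is fetched in turn from the
    rest of [d2], with backtracking when several candidates fit. *)
Fixpoint align (d1 : diag) (i : nat) (d2 : diag) : option diag :=
  if d1 is s :: d1' then
    pick_first (fun j =>
      if swaps (rev (iota i (j - i))) d2 is Some d2' then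
        if nth null_slice d2' i == s then align d1' i.+1 d2' else None
      else None) (iota i (size d2 - i))
  else Some d2.

Definition nat_rules (bs os : seq nat) : seq rule :=
  flatten [seq [seq Nat (nat_lr (inl g)) b (inl g) a | b <- [:: true; false]]
            | g <- bs, a <- os].

(* The Yang-Baxter equation is naturality with respect to a crossing. *)
Definition yb_rules (os : seq nat) : seq rule :=
  flatten [seq [seq Nat true false (inr (a, b)) c | c <- os] | a <- os, b <- os].

End Search.

(** * Soundness of the rewriting *)

Section Soundness.
Variables (C : braidedCategory) (ob : seq (obj C)) (ar : seq (word * word)).
Variable bx : seq (mor C).

Definition wf_env := size ar = size bx /\ well_formed ob ar bx.
Hypothesis W : wf_env.

Definition valid (r : rule) : Prop :=
  if r is Eqn l r then
    [&& twt ar l, twt ar r, tdom ar r == tdom ar l & tcod ar r == tcod ar l]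
    /\ eval ob bx l = eval ob bx r
  else True.

Lemma nat_sidesP b g a : let: (w, (l, r)) := nat_sides ar b g a in
  [/\ wt ar w l, wt ar w r, endw ar w r = endw ar w l
    & dden ob ar bx w l = dden ob ar bx w r].
Proof.
have [szP bxP] := W; have hg := gmorP szP bxP g.
have dg : dden ob ar bx (gdom ar g) [:: (0, g)] = gmor ob bx g.
  have := sden_cat ob ar bx [::] g [::]; have := after_cat ar [::] g [::].
  by rewrite /= !cats0 => -> ->; rewrite tenM1l tenM1r (hom_comp1l hg).
have wg : wt ar (gdom ar g) [:: (0, g)].
  by have := wt1_cat ar [::] g [::]; rewrite cats0.
have eg : endw ar (gdom ar g) [:: (0, g)] = gcod ar g.
  by have := after_cat ar [::] g [::]; rewrite /= !cats0.
case: b => /=.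
- have [wc ec] := crossP ar [:: a] (gcod ar g).
  have [wc' ec'] := crossP ar [:: a] (gdom ar g).
  have [ws es] := wt_shift [:: a] [::] wg; have ds := dden_shift szP bxP [:: a] [::] wg.
  have [wz ez] := wt_shift [::] [:: a] wg; have dz := dden_shift szP bxP [::] [:: a] wg.
  rewrite shift0 !cats0 eg !cat0s in ws es ds wz ez dz.
  have wl : wt ar ([:: a] ++ gdom ar g)
      (shift 1 [:: (0, g)] ++ cross [:: a] (gcod ar g)).
    by rewrite wt_cat ws es.
  have wr : wt ar ([:: a] ++ gdom ar g) (cross [:: a] (gdom ar g) ++ [:: (0, g)]).
    by rewrite wt_cat wc' ec'.
  have e1 := dden_cat szP bxP wl; have e2 := dden_cat szP bxP wr.
  rewrite es ds (cross_den szP bxP [:: a] (gcod ar g)) tenM1r dg in e1.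
  rewrite ec' dz (cross_den szP bxP [:: a] (gdom ar g)) tenM1l dg in e2.
  split=> //.
    have f1 := endw_cat ar ([:: a] ++ gdom ar g) (shift 1 [:: (0, g)])
      (cross [:: a] (gcod ar g)).
    have f2 := endw_cat ar ([:: a] ++ gdom ar g) (cross [:: a] (gdom ar g))
      [:: (0, g)].
    by rewrite es ec in f1; rewrite ec' ez in f2; exact: etrans f2 (esym f1).
  rewrite [LHS]e1 [RHS]e2 /= tenO1r; case: hg => <- <-.
  have := braid_natural (idm (nth unitO ob a)) (gmor ob bx g).
  by rewrite cod_idm dom_idm.
- have [wc ec] := crossP ar (gcod ar g) [:: a].
  have [wc' ec'] := crossP ar (gdom ar g) [:: a].
  have [ws es] := wt_shift [::] [:: a] wg; have ds := dden_shift szP bxP [::] [:: a] wg.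
  have [wz ez] := wt_shift [:: a] [::] wg; have dz := dden_shift szP bxP [:: a] [::] wg.
  rewrite shift0 !cats0 eg !cat0s in ws es ds wz ez dz.
  have wl : wt ar (gdom ar g ++ [:: a]) ([:: (0, g)] ++ cross (gcod ar g) [:: a]).
    by rewrite wt_cat ws es.
  have wr : wt ar (gdom ar g ++ [:: a]) (cross (gdom ar g) [:: a] ++ [:: (1, g)]).
    by rewrite wt_cat wc' ec'.
  have e1 := dden_cat szP bxP wl; have e2 := dden_cat szP bxP wr.
  rewrite es ds (cross_den szP bxP (gcod ar g) [:: a]) tenM1l dg in e1.
  rewrite ec' dz (cross_den szP bxP (gdom ar g) [:: a]) tenM1r dg in e2.
  split=> //.
    have f1 := endw_cat ar (gdom ar g ++ [:: a]) [:: (0, g)]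
      (cross (gcod ar g) [:: a]).
    have f2 := endw_cat ar (gdom ar g ++ [:: a]) (cross (gdom ar g) [:: a])
      [:: (1, g)].
    by rewrite es ec in f1; rewrite ec' ez in f2; exact: etrans f2 (esym f1).
  rewrite [LHS]e1 [RHS]e2 /= tenO1r; case: hg => <- <-.
  have := braid_natural (gmor ob bx g) (idm (nth unitO ob a)).
  by rewrite cod_idm dom_idm.
Qed.

Lemma sidesP r : valid r -> let: (w, (d, d')) := sides ar r in
  [/\ wt ar w d, wt ar w d', endw ar w d' = endw ar w d
    & dden ob ar bx w d = dden ob ar bx w d'].
Proof.
have [szP bxP] := W; case: r => [l r|fwd b g a] /=; last first.
  move=> _; have := nat_sidesP b g a; case: nat_sides => w [l r].
  by case: ifP => _ [? ? -> ->].
case=> /and4P[wl wr /eqP ed /eqP ec] e.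
have [wl' el dl] := flatP szP bxP wl; have [wr' er dr] := flatP szP bxP wr.
by rewrite -ed; rewrite ed in wr' er dr *; split; rewrite // ?el ?er ?dl ?dr.
Qed.

Local Notation refines := (refines ob ar bx).

(** [apply_at] checks afresh that the left side occurs literally on matching strands, so the
    equation only has to be tensored with identities. *)
Lemma apply_atP r p k w d d' : valid r -> apply_at ar r p k w d = Some d' ->
  refines w d d'.
Proof.
have [szP bxP] := W; move=> /sidesP; rewrite /apply_at.
case: (sides ar r) => w0 [l l'] [wl wl' e' dl].
case: ifP => // /and3P[/eqP el le_k /prefixP[v ev]] [<-].
have ed : d = take p d ++ shift k l ++ drop (p + size l) d.
  by rewrite -el addnC -drop_drop !cat_take_drop.
rewrite {1}ed; apply: refines_cat => //; set w' := endw ar w _ in le_k ev *.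
have -> : w' = take k w' ++ w0 ++ v by rewrite -ev cat_take_drop.
have sk : k = size (take k w') by rewrite size_takel.
move: (take k w') sk => u -> {w' le_k ev ed el}.
have [t1 t2] := wt_shift u v wl; have [t3 t4] := wt_shift u v wl'.
by split; rewrite // ?t4 ?t2 ?e' // !dden_shift // dl.
Qed.

Lemma swapsP ps w d d' : swaps ar ps d = Some d' -> refines w d d'.
Proof.
have [szP bxP] := W.
elim: ps d => [|p ps IHps] d /=; first by case=> <-.
case E: (swap ar p d) => [e|] //= /IHps.
exact: refines_trans (refines_swap szP bxP E).
Qed.

Lemma rewrite_atP r w d i d' : valid r -> rewrite_at ar r w d i = Some d' ->
  refines w d d'.
Proof.
move=> vr; rewrite /rewrite_at; case: (sides ar r).2.1 => // e ls.
case: ifP => // _; case: find_rest => // [[[ps p] k]].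
case E: swaps => [d1|] //= /(apply_atP vr).
exact: refines_trans (swapsP E).
Qed.

Lemma pick_firstP (A B : Type) (f : A -> option B) s y :
  pick_first f s = Some y -> exists x, f x = Some y.
Proof.
elim: s => //= x s IHs; case E: (f x) => [z|] // [<-]; by exists x.
Qed.

Lemma rewrite_nthP n r w d : valid r -> refines w d (rewrite_nth ar n r w d).
Proof.
rewrite /rewrite_nth => vr; elim: (iota _ _) n => [|i s IHs] n /=.
  by rewrite nth_nil.
case E: rewrite_at => [d'|] //=; case: n => //=.
exact: rewrite_atP E.
Qed.

Fixpoint valid_all (rs : seq rule) : Prop :=
  if rs is r :: rs' then valid r /\ valid_all rs' else True.

Lemma rewrite_firstP rs w d d' : valid_all rs ->
  rewrite_first ar rs w d = Some d' -> refines w d d'.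
Proof.
rewrite /rewrite_first; elim: rs => //= r rs IHrs [vr /IHrs IH].
case E: pick_first => [e|] // [<-].
by have [i] := pick_firstP E; apply: rewrite_atP.
Qed.

Lemma normP n rs w d : valid_all rs -> refines w d (norm ar n rs w d).
Proof.
move=> vrs; elim: n d => //= n IHn d.
case E: rewrite_first => [e|] //; exact: refines_trans (rewrite_firstP vrs E) (IHn e).
Qed.

Lemma alignP d1 i w d2 d : align ar d1 i d2 = Some d -> refines w d2 d.
Proof.
elim: d1 i d2 => [|s d1 IHd1] i d2 /=; first by case=> <-.
move=> E; have [j] := pick_firstP E; case E1: swaps => [d3|] //.
by case: ifP => // _ /IHd1; apply: refines_trans (swapsP E1).
Qed.

Definition is_nat (r : rule) : bool := if r is Nat _ _ _ _ then true else false.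

(** Naturality rules are always valid, so proofs are supplied for the equational rules only. *)
Lemma valid_cat_nats rs ns : valid_all rs -> all is_nat ns -> valid_all (rs ++ ns).
Proof.
move=> vrs vns; elim: rs vrs => /= [_|r rs IHrs [vr /IHrs //]].
by elim: ns vns => //= -[] //= fwd b g a ns IHns /IHns.
Qed.

Lemma eval_eqP l r :
  [&& twt ar l, twt ar r, tdom ar r == tdom ar l & tcod ar r == tcod ar l] ->
  dden ob ar bx (tdom ar l) (flat ar l) = dden ob ar bx (tdom ar l) (flat ar r) ->
  eval ob bx l = eval ob bx r.
Proof.
have [szP bxP] := W.
case/and4P=> /(flatP szP bxP)[_ _ <-] /(flatP szP bxP)[_ _ <-] /eqP -> _ //.
Qed.

Lemma eval_hom t : twt ar t ->
  hom (wobj ob (tdom ar t)) (wobj ob (tcod ar t)) (eval ob bx t).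
Proof.
have [szP bxP] := W; move=> /(flatP szP bxP)[w <- <-]; exact: dden_hom.
Qed.

Lemma rewrite_step n r w d d' e : valid r ->
  wt ar w d && (rewrite_nth ar n r w d == d') ->
  dden ob ar bx w d' = e -> dden ob ar bx w d = e.
Proof.
move=> vr /andP[wd /eqP ed] <-; have := rewrite_nthP n (w := w) (d := d) vr.
by rewrite ed => /(_ wd)[_ _ ->].
Qed.

Lemma norm_step n rs ns w d d' e : valid_all rs ->
  [&& all is_nat ns, wt ar w d & norm ar n (rs ++ ns) w d == d'] ->
  dden ob ar bx w d' = e -> dden ob ar bx w d = e.
Proof.
move=> vrs /and3P[vns wd /eqP ed] <-.
have := normP n (w := w) (d := d) (valid_cat_nats vrs vns).
by rewrite ed => /(_ wd)[_ _ ->].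
Qed.

Lemma align_eq w d d' : wt ar w d' && (align ar d 0 d' == Some d) ->
  dden ob ar bx w d = dden ob ar bx w d'.
Proof. by case/andP=> wd' /eqP /alignP /(_ wd')[]. Qed.

End Soundness.

(** * Reification and tactics *)

Ltac lookup x l :=
  lazymatch l with
  | cons x _ => constr:(O)
  | cons _ ?l' => let n := lookup x l' in constr:(S n)
  end.

Ltac reify_obj obs e :=
  match e with
  | _ => let n := lookup e obs in constr:(OAtom n)
  | unitO => constr:(OUnit)
  | tenO ?a ?b =>
      let a' := reify_obj obs a in let b' := reify_obj obs b in
      constr:(OTen a' b')
  end.

Ltac reify obs bxs e :=
  lazymatch e with
  | comp ?g ?f =>
      let g' := reify obs bxs g in let f' := reify obs bxs f in
      constr:(TComp g' f')
  | tenM ?f ?g =>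
      let f' := reify obs bxs f in let g' := reify obs bxs g in
      constr:(TTen f' g')
  | idm ?a => let a' := reify_obj obs a in constr:(TId a')
  | braid ?a ?b =>
      let a' := reify_obj obs a in let b' := reify_obj obs b in
      constr:(TBr a' b')
  | _ => let n := lookup e bxs in constr:(TBox n)
  end.

Ltac diagram W :=
  lazymatch type of W with wf_env ?ob ?ar ?bx =>
  lazymatch goal with |- ?l = ?r =>
  let ob' := eval hnf in ob in let bx' := eval hnf in bx in
  let l' := reify ob' bx' l in let r' := reify ob' bx' r in
  let w := eval vm_compute in (tdom ar l') in
  let d1 := eval vm_compute in (flat ar l') in
  let d2 := eval vm_compute in (flat ar r') in
  refine (@eval_eqP _ ob ar bx W l' r' _ _);
  [vm_compute; reflexivity | change (dden ob ar bx w d1 = dden ob ar bx w d2)]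
  end end.

Ltac typed W :=
  lazymatch type of W with wf_env ?ob ?ar ?bx =>
  lazymatch goal with |- hom _ _ ?f =>
  let ob' := eval hnf in ob in let bx' := eval hnf in bx in
  let t := reify ob' bx' f in
  refine (hom_eq (@eval_hom _ ob ar bx W t _) _ _);
  [ vm_compute; reflexivity
  | rewrite /wobj /= ?tenOA ?tenO1l ?tenO1r //
  | rewrite /wobj /= ?tenOA ?tenO1l ?tenO1r // ]
  end end.

Ltac rule_of ob bx H :=
  let T := type of H in let T := eval hnf in T in
  lazymatch T with ?l = ?r =>
  let ob' := eval hnf in ob in let bx' := eval hnf in bx in
  let l' := reify ob' bx' l in let r' := reify ob' bx' r in
  constr:(Eqn l' r') end.

Ltac env_of ob ar bx :=
  lazymatch goal with W : wf_env ob ar bx |- _ => W end.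

Ltac drw n H :=
  lazymatch goal with |- dden ?ob ?ar ?bx ?w ?d = _ =>
  let W := env_of ob ar bx in
  let r := rule_of ob bx H in
  let d' := eval vm_compute in (rewrite_nth ar n r w d) in
  tryif constr_eq d d' then fail "no match" else
  refine (@rewrite_step _ ob ar bx W n r w d d' _ (conj _ H) _ _);
  [vm_compute; reflexivity | vm_compute; reflexivity | ]
  end.

Tactic Notation "slide" constr(n) constr(fwd) constr(b) constr(g) constr(a) :=
  lazymatch goal with |- dden ?ob ?ar ?bx ?w ?d = _ =>
  let W := env_of ob ar bx in
  let ob' := eval hnf in ob in let bx' := eval hnf in bx in
  let i := lookup g bx' in let j := lookup a ob' in
  let r := constr:(Nat fwd b (inl i) j) in
  let d' := eval vm_compute in (rewrite_nth ar n r w d) in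
  tryif constr_eq d d' then fail "no match" else
  refine (@rewrite_step _ ob ar bx W n r w d d' _ I _ _);
  [vm_compute; reflexivity | ]
  end.

Ltac rules_of ob bx Hs :=
  lazymatch Hs with
  | (?Hs', ?H) => let rs := rules_of ob bx Hs' in let r := rule_of ob bx H in
      constr:(cons r rs)
  | tt => constr:(@nil rule)
  end.

Ltac valid_rules Hs :=
  lazymatch Hs with
  | (?Hs', ?H) => refine (conj (conj _ H) _);
      [vm_compute; reflexivity | valid_rules Hs']
  | tt => exact I
  end.

Ltac dnorm fuel Hs ns :=
  lazymatch goal with |- dden ?ob ?ar ?bx ?w ?d = _ =>
  let W := env_of ob ar bx in
  let rs := rules_of ob bx Hs in
  let d' := eval vm_compute in (norm ar fuel (rs ++ ns) w d) in
  refine (@norm_step _ ob ar bx W fuel rs ns w d d' _ _ _ _);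
  [valid_rules Hs | vm_compute; reflexivity | ]
  end.

Ltac dclose := refine (align_eq _ _); [assumption | vm_compute; reflexivity].

Local Open Scope mor_scope.

(** * The signature of a Hopf datum *)

(* The objects 0 and 1 are B_1 and B_2.  The box f is an arbitrary endomorphism of
   B_1 ⊗ B_2 ⊗ B_1 ⊗ B_2, to which the map Φ is applied. *)
Definition hopf_ob (C : braidedCategory) (H : hopfData C) : seq (obj C) :=
  [:: car (B1 H); car (B2 H)].

Definition hopf_ar : seq (word * word) :=
  [:: ([:: 0; 0], [:: 0]); ([::], [:: 0]); ([:: 0], [:: 0; 0]); ([:: 0], [::]);
      ([:: 1; 1], [:: 1]); ([::], [:: 1]); ([:: 1], [:: 1; 1]); ([:: 1], [::]);
      ([:: 1; 0], [:: 0]); ([:: 0], [:: 1; 0]);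
      ([:: 1; 0], [:: 1]); ([:: 1], [:: 1; 0]);
      ([:: 0; 1; 0; 1], [:: 0; 1; 0; 1]);
      ([:: 0; 1], [:: 1; 0]); ([:: 1; 0], [:: 0; 1])].

Definition hopf_bx (C : braidedCategory) (H : hopfData C) (f : mor C) :
    seq (mor C) :=
  [:: mul (B1 H); eta (B1 H); Delta (B1 H); eps (B1 H);
      mul (B2 H); eta (B2 H); Delta (B2 H); eps (B2 H);
      mu_l H; nu_l H; mu_r H; nu_r H; f; phi12 H; phi21 H].

(** Boxes 0 to 11 are the structure morphisms; [f], [phi12] and [phi21] are not moved through
    crossings. *)
Definition hopf_nat : seq rule :=
  nat_rules hopf_ar (iota 0 12) [:: 0; 1] ++ yb_rules [:: 0; 1].

Section HopfDatum.
Variables (C : braidedCategory) (H : hopfData C).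
Hypothesis HH : is_hopf_datum H.
Local Notation m1 := (mul (B1 H)).
Local Notation m2 := (mul (B2 H)).
Local Notation η1 := (eta (B1 H)).
Local Notation η2 := (eta (B2 H)).
Local Notation Δ1 := (Delta (B1 H)).
Local Notation Δ2 := (Delta (B2 H)).
Local Notation ε1 := (eps (B1 H)).
Local Notation ε2 := (eps (B2 H)).
Local Notation b1 := (car (B1 H)).
Local Notation b2 := (car (B2 H)).
Local Notation id1 := (idm b1).
Local Notation id2 := (idm b2).
Local Notation μl := (mu_l H).
Local Notation νl := (nu_l H).
Local Notation μr := (mu_r H).
Local Notation νr := (nu_r H).
Local Notation Ψ11 := (braid b1 b1).
Local Notation Ψ12 := (braid b1 b2).
Local Notation Ψ21 := (braid b2 b1).
Local Notation Ψ22 := (braid b2 b2).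
Local Notation φ12 := (phi12 H).
Local Notation φ21 := (phi21 H).
Local Notation b12 := (b1 ⊗ b2)%obj.
Local Notation mB := (mul (crossB H)).
Local Notation ΔB := (Delta (crossB H)).

Lemma hopf_wf (f : mor C) :
  hom (b1 ⊗ b2 ⊗ b1 ⊗ b2) (b1 ⊗ b2 ⊗ b1 ⊗ b2) f ->
  wf_env (hopf_ob H) hopf_ar (hopf_bx H f).
Proof.
have [? ? _ _ _] := hd_alg1 HH; have [? ? _ _ _] := hd_alg2 HH.
have [? ? _ _ _] := hd_coalg1 HH; have [? ? _ _ _] := hd_coalg2 HH.
have [? _ _] := hd_mu_l HH; have [? _ _] := hd_nu_l HH.
have [? _ _] := hd_mu_r HH; have [? _ _] := hd_nu_r HH.
have ? := hom_phi12 HH; have ? := hom_phi21 HH.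
move=> ?; split=> // n.
by do 15?[case: n => [_ /=|n]; first by rewrite ?tenO1r -?tenOA].
Qed.

(** The slot of [f] holds an identity until [Phi] is studied. *)
Let W : wf_env (hopf_ob H) hopf_ar (hopf_bx H (idm (b1 ⊗ b2 ⊗ b1 ⊗ b2))).
Proof. exact: hopf_wf (hom_idm _). Qed.

Let mulA1 := mul_assoc (hd_alg1 HH).
Let mulA2 := mul_assoc (hd_alg2 HH).
Let mul1l := mul_unitl (hd_alg1 HH).
Let mul1r := mul_unitr (hd_alg1 HH).
Let mul2l := mul_unitl (hd_alg2 HH).
Let mul2r := mul_unitr (hd_alg2 HH).
Let coA1 := Delta_coassoc (hd_coalg1 HH).
Let coA2 := Delta_coassoc (hd_coalg2 HH).
Let co1l := Delta_counitl (hd_coalg1 HH).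
Let co1r := Delta_counitr (hd_coalg1 HH).
Let co2l := Delta_counitl (hd_coalg2 HH).
Let co2r := Delta_counitr (hd_coalg2 HH).
Let eps_m1 : ε1 ∘ m1 = idm unitO ∘ (ε1 ⊗ ε1). Proof. by case: (hd_eps1 HH). Qed.
Let eps_m2 : ε2 ∘ m2 = idm unitO ∘ (ε2 ⊗ ε2). Proof. by case: (hd_eps2 HH). Qed.
Let eps_eta1 : ε1 ∘ η1 = idm unitO. Proof. by case: (hd_eps1 HH). Qed.
Let eps_eta2 : ε2 ∘ η2 = idm unitO. Proof. by case: (hd_eps2 HH). Qed.
Let Delta_eta1 : Δ1 ∘ η1 = (η1 ⊗ η1) ∘ idm unitO.
Proof. by case: (hd_eta1 HH). Qed.
Let Delta_eta2 : Δ2 ∘ η2 = (η2 ⊗ η2) ∘ idm unitO.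
Proof. by case: (hd_eta2 HH). Qed.
Let mu_lA : μl ∘ (m2 ⊗ id1) = μl ∘ (id2 ⊗ μl). Proof. by case: (hd_mu_l HH). Qed.
Let mu_l1 : μl ∘ (η2 ⊗ id1) = id1. Proof. by case: (hd_mu_l HH). Qed.
Let mu_rA : μr ∘ (μr ⊗ id1) = μr ∘ (id2 ⊗ m1). Proof. by case: (hd_mu_r HH). Qed.
Let mu_r1 : μr ∘ (id2 ⊗ η1) = id2. Proof. by case: (hd_mu_r HH). Qed.
Let nu_lA : (Δ2 ⊗ id1) ∘ νl = (id2 ⊗ νl) ∘ νl. Proof. by case: (hd_nu_l HH). Qed.
Let nu_l1 : (ε2 ⊗ id1) ∘ νl = id1. Proof. by case: (hd_nu_l HH). Qed.
Let nu_rA : (νr ⊗ id1) ∘ νr = (id2 ⊗ Δ1) ∘ νr. Proof. by case: (hd_nu_r HH). Qed.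
Let nu_r1 : (id2 ⊗ ε1) ∘ νr = id2. Proof. by case: (hd_nu_r HH). Qed.
Let phi12E : φ12 = (m2 ⊗ m1) ∘ (id2 ⊗ Ψ12 ⊗ id1) ∘ (νl ⊗ νr). Proof. by []. Qed.
Let phi21E : φ21 = (μl ⊗ μr) ∘ (id2 ⊗ Ψ21 ⊗ id1) ∘ (Δ2 ⊗ Δ1). Proof. by []. Qed.

(** The simplifying laws. The long compatibility axioms are left out and applied one at a time. *)
Ltac basic_laws := constr:((tt, mulA1, mulA2, coA1, coA2, mu_lA, mu_rA, nu_lA,
  nu_rA, mul1l, mul1r, mul2l, mul2r, co1l, co1r, co2l, co2r, eps_m1, eps_m2,
  eps_eta1, eps_eta2, Delta_eta1, Delta_eta2, mu_l1, mu_r1, nu_l1, nu_r1,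
  hd_mu_r_eta HH, hd_nu_l_eps HH, hd_eps_mu_r HH, hd_eps_mu_l HH,
  hd_mu_l_eta HH, hd_nu_r_eps HH, hd_nu_r_eta HH, hd_nu_l_eta HH)).

Ltac simp := let L := basic_laws in dnorm 300 L hopf_nat.
Ltac simp_with T := let L := basic_laws in dnorm 300 (L, T) hopf_nat.
Ltac expand := let L := basic_laws in dnorm 300 (L, phi12E, phi21E) hopf_nat.
Ltac expand_with T :=
  let L := basic_laws in dnorm 300 (L, phi12E, phi21E, T) hopf_nat.
Ltac dsolve := expand; symmetry; expand; symmetry; dclose.
Ltac dsolve_with T := expand_with T; symmetry; expand_with T; symmetry; dclose.

(** * The cross product algebra and coalgebra *)

Lemma phi21_eta1 : φ21 ∘ (id2 ⊗ η1) = η1 ⊗ id2.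
Proof. by diagram W; dsolve. Qed.

Lemma phi21_eta2 : φ21 ∘ (η2 ⊗ id1) = id1 ⊗ η2.
Proof. by diagram W; dsolve. Qed.

Lemma phi12_eps1 : (id2 ⊗ ε1) ∘ φ12 = ε1 ⊗ id2.
Proof. by diagram W; dsolve. Qed.

Lemma phi12_eps2 : (ε2 ⊗ id1) ∘ φ12 = id1 ⊗ ε2.
Proof. by diagram W; dsolve. Qed.

(** With [phi21_mul1], this makes [φ21] a distributive law, whence associativity of B. The left side
    unfolds by the axioms for [Δ2 ∘ m2] and [μr ∘ (m2 ⊗ id1)], the right side by the one for
    [Δ1 ∘ μl]. *)
Lemma phi21_mul2 : φ21 ∘ (m2 ⊗ id1) = (id1 ⊗ m2) ∘ (φ21 ⊗ id2) ∘ (id2 ⊗ φ21).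
Proof.
diagram W; expand; drw 0 (hd_alg_coalg2 HH); simp.
drw 0 (hd_mod_alg_r HH); expand; symmetry.
by expand; drw 0 (hd_mod_coalg_l HH); simp; dclose.
Qed.

Lemma phi21_mul1 : φ21 ∘ (id2 ⊗ m1) = (m1 ⊗ id2) ∘ (id1 ⊗ φ21) ∘ (φ21 ⊗ id1).
Proof.
diagram W; expand; drw 0 (hd_alg_coalg1 HH); simp.
drw 0 (hd_mod_alg_l HH); expand; symmetry.
by expand; drw 0 (hd_mod_coalg_r HH); simp; dclose.
Qed.

(** Dual to [phi21_mul1]: the codistributive law behind coassociativity of B. *)
Lemma phi12_Delta1 : (id2 ⊗ Δ1) ∘ φ12 = (φ12 ⊗ id1) ∘ (id1 ⊗ φ12) ∘ (Δ1 ⊗ id2).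
Proof.
diagram W; expand; drw 0 (hd_alg_coalg1 HH); simp.
drw 0 (hd_comod_coalg_l HH); expand; symmetry.
by expand; drw 0 (hd_comod_alg_r HH); simp; symmetry; dclose.
Qed.

Lemma phi12_Delta2 : (Δ2 ⊗ id1) ∘ φ12 = (id2 ⊗ φ12) ∘ (φ12 ⊗ id2) ∘ (id1 ⊗ Δ2).
Proof.
diagram W; expand; drw 0 (hd_alg_coalg2 HH); simp.
drw 0 (hd_comod_coalg_r HH); expand; symmetry.
by expand; drw 0 (hd_comod_alg_l HH); simp; symmetry; dclose.
Qed.

Lemma crossB_algebra : is_algebra (crossB H).
Proof.
split; [exact: hom_crossB_mul | rewrite /=; by typed W | | | ]; rewrite /=.
- diagram W; drw 0 phi21_mul2; simp; symmetry.
  by drw 0 phi21_mul1; simp; symmetry; dclose.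
- by diagram W; drw 0 phi21_eta2; simp; dclose.
- by diagram W; drw 0 phi21_eta1; simp; dclose.
Qed.

Lemma crossB_coalgebra : is_coalgebra (crossB H).
Proof.
split; [exact: hom_crossB_Delta | rewrite /=; by typed W | | | ]; rewrite /=.
- diagram W; drw 0 phi12_Delta2; simp; symmetry.
  by drw 0 phi12_Delta1; simp; symmetry; dclose.
- by diagram W; drw 0 phi12_eps2; simp; dclose.
- by diagram W; drw 0 phi12_eps1; simp; dclose.
Qed.

(* The multiplication of the braided tensor square of B, and the restrictions of
   Δ_B along the algebra morphisms id ⊗ η_2 : B_1 -> B and η_1 ⊗ id : B_2 -> B. *)
Definition mBB : mor C := (mB ⊗ mB) ∘ (idm b12 ⊗ braid b12 b12 ⊗ idm b12).
Definition Delta_gen1 : mor C := (id1 ⊗ νl ⊗ η2) ∘ Δ1.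
Definition Delta_gen2 : mor C := (η1 ⊗ νr ⊗ id2) ∘ Δ2.

(** On the subalgebra B_1, multiplicativity of Δ_B follows from the algebra-coalgebra axiom for B_1
    and the comodule-algebra axiom for [νl]. *)
Lemma Delta_gen1_mul : Delta_gen1 ∘ m1 = mBB ∘ (Delta_gen1 ⊗ Delta_gen1).
Proof.
rewrite /Delta_gen1 /mBB /=; diagram W; drw 0 (hd_alg_coalg1 HH); simp.
by drw 0 (hd_comod_alg_l HH); simp; symmetry; expand; symmetry; dclose.
Qed.

Lemma Delta_gen2_mul : Delta_gen2 ∘ m2 = mBB ∘ (Delta_gen2 ⊗ Delta_gen2).
Proof.
rewrite /Delta_gen2 /mBB /=; diagram W; drw 0 (hd_alg_coalg2 HH); simp.
by drw 0 (hd_comod_alg_r HH); simp; symmetry; expand; symmetry; dclose.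
Qed.

Lemma Delta_gens : ΔB = mBB ∘ (Delta_gen1 ⊗ Delta_gen2).
Proof. by rewrite /Delta_gen1 /Delta_gen2 /mBB /=; diagram W; dsolve. Qed.

(* Multiplicativity of Δ_B on the products x b with x in B_2 and b in B_1: the only
   case that does not follow from the axioms of a Hopf datum alone. *)
Definition Delta_phi21_compatible : Prop :=
  (id1 ⊗ φ12 ⊗ id2) ∘ (Δ1 ⊗ Δ2) ∘ φ21 =
  (id1 ⊗ m2 ⊗ m1 ⊗ id2) ∘ (φ21 ⊗ id2 ⊗ id1 ⊗ φ21)
  ∘ (id2 ⊗ braid b12 b12 ⊗ id1) ∘ (νr ⊗ id2 ⊗ id1 ⊗ νl) ∘ (Δ2 ⊗ Δ1).

Lemma Delta_gens_rev : Delta_phi21_compatible ->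
  ΔB ∘ φ21 = mBB ∘ (Delta_gen2 ⊗ Delta_gen1).
Proof.
rewrite /Delta_phi21_compatible /= => ->.
by rewrite /Delta_gen1 /Delta_gen2 /mBB /=; diagram W; dsolve.
Qed.

Lemma mBB_assoc : mBB ∘ (mBB ⊗ idm (b12 ⊗ b12)) = mBB ∘ (idm (b12 ⊗ b12) ⊗ mBB).
Proof.
have mA : mB ∘ (mB ⊗ idm b12) = mB ∘ (idm b12 ⊗ mB) := mul_assoc crossB_algebra.
(* B becomes a single strand: associativity of [mB] and naturality of the braiding suffice. *)
pose ar := [:: ([:: 0; 0], [:: 0])] : seq (word * word).
have WB : wf_env [:: b12] ar [:: mB].
  by split=> // -[_|//]; have := hom_crossB_mul HH; rewrite /wobj /= !tenO1r.
rewrite /mBB; diagram WB; dnorm 100 (tt, mA) (nat_rules ar [:: 0] [:: 0]); symmetry.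
by dnorm 100 (tt, mA) (nat_rules ar [:: 0] [:: 0]); symmetry; dclose.
Qed.

(* a x b y = (a b') (x' y) with b' ⊗ x' = φ_{2,1}(x ⊗ b), so that the
   multiplicativity of Δ_B reduces to products of generators. *)
Lemma crossB_Delta_mul : Delta_phi21_compatible -> ΔB ∘ mB = mBB ∘ (ΔB ⊗ ΔB).
Proof.
move=> /Delta_gens_rev Delta_rev.
(* The composites become opaque boxes, so that the calculation only sees products of generators. *)
have WG : wf_env [:: b1; b2]
    [:: ([:: 0; 0], [:: 0]); ([:: 1; 1], [:: 1]); ([:: 1; 0], [:: 0; 1]);
        ([:: 0; 1; 0; 1; 0; 1; 0; 1], [:: 0; 1; 0; 1]);
        ([:: 0], [:: 0; 1; 0; 1]); ([:: 1], [:: 0; 1; 0; 1]);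
        ([:: 0; 1], [:: 0; 1; 0; 1])]
    [:: m1; m2; φ21; mBB; Delta_gen1; Delta_gen2; ΔB].
  have h1 : hom b1 (b12 ⊗ b12) Delta_gen1 by rewrite /Delta_gen1; typed W.
  have h2 : hom b2 (b12 ⊗ b12) Delta_gen2 by rewrite /Delta_gen2; typed W.
  have hM : hom (b12 ⊗ b12 ⊗ (b12 ⊗ b12)) (b12 ⊗ b12) mBB.
    by rewrite /mBB /=; typed W.
  have hm1 := mul_hom (hd_alg1 HH); have hm2 := mul_hom (hd_alg2 HH).
  have hphi := hom_phi21 HH; have hD := hom_crossB_Delta HH.
  move: h1 h2 hM hD; rewrite !tenOA => h1 h2 hM hD; split=> // n.
  by do 7?[case: n => [_|n]; first by rewrite /wobj /= !tenO1r].
have mE : mB = (m1 ⊗ m2) ∘ (id1 ⊗ φ21 ⊗ id2) by [].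
rewrite [mB in LHS]mE; diagram WG.
drw 0 Delta_gens; drw 0 Delta_gen1_mul; drw 0 Delta_gen2_mul.
dnorm 20 (tt, mBB_assoc) (@nil rule); drw 0 (esym mBB_assoc).
(* The regrouped inner factors Δ_B(b') Δ_B(x') fold into [ΔB ∘ φ21], which [Delta_rev] turns into
   Δ_B(x) Δ_B(b). *)
drw 0 (esym Delta_gens); drw 0 Delta_rev.
dnorm 20 (tt, mBB_assoc) (@nil rule); symmetry.
by dnorm 20 (tt, mBB_assoc, Delta_gens) (@nil rule); symmetry; dclose.
Qed.

Lemma crossB_bialgebra : Delta_phi21_compatible -> is_bialgebra (crossB H).
Proof.
move=> compat; split.
- exact: crossB_algebra.
- exact: crossB_coalgebra.
- exact: crossB_Delta_mul.
- by split; rewrite /=; [typed W | diagram W; dsolve | diagram W; dsolve].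
- by split; rewrite /=; [typed W | diagram W; dsolve | diagram W; dsolve].
Qed.

(** * Trivial actions and coactions *)

(** For the converse, the product of x in B_2 by b in B_1 projects to μ_l(x ⊗ b), whereas
    multiplicativity of the projection gives ε_2(x) b. *)
Lemma trivial_mu_l_iff :
  trivial_mu_l H <-> alg_coalg_morphism (crossB H) (B1 H) (id1 ⊗ ε2).
Proof.
split=> [T|[[_ h _] _]].
  by split; split; rewrite /=; first [by typed W | by diagram W; dsolve_with T].
rewrite /= in h; rewrite /trivial_mu_l.
transitivity ((id1 ⊗ ε2) ∘ ((m1 ⊗ m2) ∘ (id1 ⊗ φ21 ⊗ id2))
              ∘ (η1 ⊗ id2 ⊗ id1 ⊗ η2)); first by diagram W; dsolve.
by rewrite h; diagram W; dsolve.
Qed.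

Lemma trivial_mu_r_iff :
  trivial_mu_r H <-> alg_coalg_morphism (crossB H) (B2 H) (ε1 ⊗ id2).
Proof.
split=> [T|[[_ h _] _]].
  by split; split; rewrite /=; first [by typed W | by diagram W; dsolve_with T].
rewrite /= in h; rewrite /trivial_mu_r.
transitivity ((ε1 ⊗ id2) ∘ ((m1 ⊗ m2) ∘ (id1 ⊗ φ21 ⊗ id2))
              ∘ (η1 ⊗ id2 ⊗ id1 ⊗ η2)); first by diagram W; dsolve.
by rewrite h; diagram W; dsolve.
Qed.

(** For the converse, applying ε_1 and ε_2 to the outer legs of Δ_B(a ⊗ 1) leaves ν_l(a), whereas
    comultiplicativity of the inclusion gives 1 ⊗ a. *)
Lemma trivial_nu_l_iff :
  trivial_nu_l H <-> alg_coalg_morphism (B1 H) (crossB H) (id1 ⊗ η2).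
Proof.
split=> [T|[_ [_ h _]]].
  by split; split; rewrite /=; first [by typed W | by diagram W; dsolve_with T].
rewrite /= in h; rewrite /trivial_nu_l.
transitivity ((ε1 ⊗ id2 ⊗ id1 ⊗ ε2)
              ∘ ((id1 ⊗ φ12 ⊗ id2) ∘ (Δ1 ⊗ Δ2) ∘ (id1 ⊗ η2))).
  by diagram W; dsolve.
by rewrite h; diagram W; dsolve.
Qed.

Lemma trivial_nu_r_iff :
  trivial_nu_r H <-> alg_coalg_morphism (B2 H) (crossB H) (η1 ⊗ id2).
Proof.
split=> [T|[_ [_ h _]]].
  by split; split; rewrite /=; first [by typed W | by diagram W; dsolve_with T].
rewrite /= in h; rewrite /trivial_nu_r.
transitivity ((ε1 ⊗ id2 ⊗ id1 ⊗ ε2)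
              ∘ ((id1 ⊗ φ12 ⊗ id2) ∘ (Δ1 ⊗ Δ2) ∘ (η1 ⊗ id2))).
  by diagram W; dsolve.
by rewrite h; diagram W; dsolve.
Qed.

(* The module-comodule identity, specialized to each trivial (co)action.  The left
   side is φ_{1,2} φ_{2,1}, with its naturality moves carried out so that it occurs
   in the diagrams of the next lemmas. *)
Lemma mod_comod_trivial_mu_l : trivial_mu_l H ->
  (m2 ⊗ m1) ∘ (id2 ⊗ Ψ12 ⊗ id1) ∘ (id2 ⊗ id1 ⊗ (νr ∘ μr)) ∘ (id2 ⊗ Ψ21 ⊗ id1)
    ∘ (Ψ22 ⊗ id1 ⊗ id1) ∘ (id2 ⊗ νl ⊗ id1) ∘ (id2 ⊗ Δ1)
  = (m2 ⊗ m1) ∘ (μr ⊗ Ψ12 ⊗ id1) ∘ (id2 ⊗ Ψ11 ⊗ id2 ⊗ id1) ∘ (νr ⊗ id1 ⊗ νl)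
    ∘ (id2 ⊗ Δ1).
Proof.
move=> T; transitivity (φ12 ∘ φ21); first by diagram W; dsolve_with T.
by rewrite (hd_mod_comod HH); diagram W; dsolve_with T.
Qed.

Lemma mod_comod_trivial_mu_r : trivial_mu_r H ->
  (m2 ⊗ m1) ∘ (id2 ⊗ Ψ12 ⊗ id1) ∘ ((νl ∘ μl) ⊗ νr) ∘ (id2 ⊗ Ψ21) ∘ (Δ2 ⊗ id1)
  = (m2 ⊗ m1) ∘ (id2 ⊗ Ψ12 ⊗ μl) ∘ (id2 ⊗ id1 ⊗ Ψ22 ⊗ id1) ∘ (νr ⊗ id2 ⊗ νl)
    ∘ (Δ2 ⊗ id1).
Proof.
move=> T; transitivity (φ12 ∘ φ21); first by diagram W; dsolve_with T.
by rewrite (hd_mod_comod HH); diagram W; dsolve_with T.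
Qed.

Lemma mod_comod_trivial_nu_l : trivial_nu_l H ->
  (id2 ⊗ m1) ∘ (id2 ⊗ μl ⊗ id1) ∘ (braid (b2 ⊗ b1) b2 ⊗ id1)
    ∘ (id2 ⊗ id1 ⊗ (νr ∘ μr)) ∘ (id2 ⊗ Ψ21 ⊗ id1) ∘ (Δ2 ⊗ Δ1)
  = (id2 ⊗ m1) ∘ (μr ⊗ id1 ⊗ μl) ∘ (id2 ⊗ Ψ11 ⊗ id2 ⊗ id1) ∘ (νr ⊗ Ψ21 ⊗ id1)
    ∘ (Δ2 ⊗ Δ1).
Proof.
move=> T; transitivity (φ12 ∘ φ21); first by diagram W; dsolve_with T.
by rewrite (hd_mod_comod HH); diagram W; dsolve_with T.
Qed.

Lemma mod_comod_trivial_nu_r : trivial_nu_r H ->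
  (m2 ⊗ id1) ∘ (id2 ⊗ μr ⊗ id1) ∘ (id2 ⊗ braid b1 (b2 ⊗ b1))
    ∘ ((νl ∘ μl) ⊗ id2 ⊗ id1) ∘ (id2 ⊗ Ψ21 ⊗ id1) ∘ (Δ2 ⊗ Δ1)
  = (m2 ⊗ id1) ∘ (μr ⊗ id2 ⊗ μl) ∘ (id2 ⊗ id1 ⊗ Ψ22 ⊗ id1) ∘ (id2 ⊗ Ψ21 ⊗ νl)
    ∘ (Δ2 ⊗ Δ1).
Proof.
move=> T; transitivity (φ12 ∘ φ21); first by diagram W; dsolve_with T.
by rewrite (hd_mod_comod HH); diagram W; dsolve_with T.
Qed.

(** With [μl] trivial, [φ21] contains no action on its B_1 output. Expanding [Δ2 ∘ μr] and [νr ∘ m2]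
    then leaves one instance of the module-comodule identity. *)
Lemma compatible_trivial_mu_l : trivial_mu_l H -> Delta_phi21_compatible.
Proof.
move=> T; rewrite /Delta_phi21_compatible; diagram W; expand_with T.
drw 0 (hd_mod_coalg_r HH); simp_with T; drw 0 (hd_comod_alg_r HH); simp_with T.
(* The normal form hides the left side of that identity; undoing (co)associativity and naturality
   exposes it. *)
drw 0 (esym mulA1); drw 0 (esym mulA2); drw 1 (esym coA1).
slide 0 true true νl b2; slide 0 true true Δ1 b2; slide 0 false false m1 b2.
drw 0 (mod_comod_trivial_mu_l T); simp_with T; symmetry.
by expand_with T; drw 0 (hd_comod_coalg_l HH); expand_with T; symmetry; dclose.
Qed.

Lemma compatible_trivial_mu_r : trivial_mu_r H -> Delta_phi21_compatible.
Proof.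
move=> T; rewrite /Delta_phi21_compatible; diagram W; expand_with T.
drw 0 (hd_mod_coalg_l HH); simp_with T; drw 0 (hd_comod_alg_l HH); simp_with T.
do 2!slide 0 true false νr b1.
drw 1 (esym coA2); slide 0 true false Δ2 b1; slide 0 false true m2 b1.
drw 0 (mod_comod_trivial_mu_r T); simp_with T; symmetry.
by expand_with T; drw 0 (hd_comod_coalg_r HH); expand_with T; symmetry; dclose.
Qed.

Lemma compatible_trivial_nu_l : trivial_nu_l H -> Delta_phi21_compatible.
Proof.
move=> T; rewrite /Delta_phi21_compatible; diagram W; expand_with T.
drw 0 (hd_mod_coalg_r HH); simp_with T; drw 0 (hd_mod_coalg_l HH); simp_with T.
drw 1 (esym coA2); drw 1 (esym coA1).
slide 0 true false Δ2 b1; slide 0 true true Δ1 b2.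
drw 0 (mod_comod_trivial_nu_l T); simp_with T; symmetry.
by expand_with T; drw 0 (hd_comod_coalg_r HH); expand_with T; symmetry; dclose.
Qed.

Lemma compatible_trivial_nu_r : trivial_nu_r H -> Delta_phi21_compatible.
Proof.
move=> T; rewrite /Delta_phi21_compatible; diagram W; expand_with T.
drw 0 (hd_mod_coalg_l HH); simp_with T; drw 0 (hd_mod_coalg_r HH); simp_with T.
drw 1 (esym coA2); drw 1 (esym coA1).
slide 0 true false Δ2 b1; slide 0 true true Δ1 b2; drw 0 (esym mulA2).
drw 0 (mod_comod_trivial_nu_r T); simp_with T; symmetry.
by expand_with T; drw 0 (hd_comod_coalg_l HH); expand_with T; symmetry; dclose.
Qed.

(** * Recursivity *)

Definition pi1 : mor C := (η1 ∘ ε1) ⊗ idm (b2 ⊗ b1 ⊗ b2).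
Definition pi4 : mor C := idm (b1 ⊗ b2 ⊗ b1) ⊗ (η2 ∘ ε2).

(* A trivial (co)action makes Φ blind to the part of f outside p f q, where p and q
   are the two halves π_1 and π_4 of π in some order; and one application of Φ
   makes the remaining half of π invisible. *)
Definition Phi_factors_through (p q : mor C) : Prop :=
  forall f, hom (b1 ⊗ b2 ⊗ b1 ⊗ b2) (b1 ⊗ b2 ⊗ b1 ⊗ b2) f ->
  Phi H f = Phi H (p ∘ f ∘ q) /\
  p ∘ Phi H f ∘ q = p ∘ Phi H (pi_mor H ∘ f ∘ pi_mor H) ∘ q.

Ltac Phi_factors T :=
  let f := fresh in let hf := fresh in let Wf := fresh in
  intros f hf; pose proof (Wf := hopf_wf hf);
  rewrite /Phi /Phi_L /Phi_L' /Phi_R /Phi_R' /Phi_P /Phi_Q /pi1 /pi4 /pi_mor;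
  by split; diagram Wf; dsolve_with T.

(** The fourth output of f acts through [μl], so it meets ε_2; the first input of f is a leg of [νr]
    whose other leg is now counited, so it is η_1. In π_4 Φ(f) π_1, the outer counit reaches the leg
    of [νl] beside the fourth input of f, and the outer unit reaches the [νl] that feeds the action
    of the first output of f. *)
Lemma Phi_factors_trivial_mu_l : trivial_mu_l H -> Phi_factors_through pi4 pi1.
Proof. by move=> T; Phi_factors T. Qed.

Lemma Phi_factors_trivial_mu_r : trivial_mu_r H -> Phi_factors_through pi1 pi4.
Proof. by move=> T; Phi_factors T. Qed.

Lemma Phi_factors_trivial_nu_l : trivial_nu_l H -> Phi_factors_through pi1 pi4.
Proof. by move=> T; Phi_factors T. Qed.

Lemma Phi_factors_trivial_nu_r : trivial_nu_r H -> Phi_factors_through pi4 pi1.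
Proof. by move=> T; Phi_factors T. Qed.

Lemma recursive_at2 p q : Phi_factors_through p q -> recursive_at H 2.
Proof.
move=> F f hf; rewrite /=.
have hp := hom_pi_mor HH.
have hg := hom_comp' hp (hom_comp' hf hp).
have [-> _] := F _ (hom_Phi HH hf).
by have [_ ->] := F _ hf; have [<- _] := F _ (hom_Phi HH hg).
Qed.

(** [recursive_at] quantifies over all endomorphisms, so the minimum is found by excluded middle at
    0 and 1. *)
Lemma recursive_order_le2 : recursive_at H 2 ->
  exists n0, recursive_of_order H n0 /\ n0 <= 2.
Proof.
move=> r2; have [r0|r0] := classic (recursive_at H 0); first by exists 0.
have [r1|r1] := classic (recursive_at H 1).
  by exists 1; split=> //; split=> // -[].
by exists 2; split=> //; split=> // -[|[|n]].
Qed.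

Lemma trivalent_recursive_compatible :
  trivalent H -> recursive_at H 2 /\ Delta_phi21_compatible.
Proof.
case=> T; split.
- exact: (recursive_at2 (Phi_factors_trivial_mu_l T)).
- exact: compatible_trivial_mu_l.
- exact: (recursive_at2 (Phi_factors_trivial_mu_r T)).
- exact: compatible_trivial_mu_r.
- exact: (recursive_at2 (Phi_factors_trivial_nu_l T)).
- exact: compatible_trivial_nu_l.
- exact: (recursive_at2 (Phi_factors_trivial_nu_r T)).
- exact: compatible_trivial_nu_r.
Qed.

End HopfDatum.

Theorem mainTheorem7 (C : braidedCategory) (splitC : idempotents_split C)
    (H : hopfData C) (HH : is_hopf_datum H) :
  ([\/ trivial_mu_l H, trivial_mu_r H, trivial_nu_l H | trivial_nu_r H] <->
   [\/ alg_coalg_morphism (B2 H) (crossB H) (eta (B1 H) ⊗ idm (car (B2 H))),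
       alg_coalg_morphism (B1 H) (crossB H) (idm (car (B1 H)) ⊗ eta (B2 H)),
       alg_coalg_morphism (crossB H) (B2 H) (eps (B1 H) ⊗ idm (car (B2 H)))
     | alg_coalg_morphism (crossB H) (B1 H) (idm (car (B1 H)) ⊗ eps (B2 H))])
  /\
  (trivalent H ->
   (exists n0 : nat, recursive_of_order H n0 /\ n0 <= 2) /\
   is_bialgebra (crossB H)).
Proof.
split.
  have [ml ml'] := trivial_mu_l_iff HH; have [mr mr'] := trivial_mu_r_iff HH.
  have [nl nl'] := trivial_nu_l_iff HH; have [nr nr'] := trivial_nu_r_iff HH.
  (* Actions correspond to projections and coactions to inclusions; the two lists run in opposite
     orders. *)
  split=> -[].
  - by move/ml; apply: Or44.
  - by move/mr; apply: Or43.
  - by move/nl; apply: Or42.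
  - by move/nr; apply: Or41.
  - by move/nr'; apply: Or44.
  - by move/nl'; apply: Or43.
  - by move/mr'; apply: Or42.
  - by move/ml'; apply: Or41.
move=> tr; have [r2 compat] := trivalent_recursive_compatible HH tr.
by split; [exact: recursive_order_le2|exact: crossB_bialgebra].
Qed.
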